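(* Let $(S,X,T)\sim P_{S,X,T}$ be discrete random variables, and for $r\ge 0$ let $$g^{r}_{0}(P_{S,X,T})=\sup_{P_{Y\mid S,X,T}:\ I(Y;S)=0,\ I(X;Y)\leq r} I(Y;T).$$ Define $$U_0=H(T)+\sum_{t\in\mathcal{T}}\int_{0}^{1} \mathbb{P}_S\{P_{T\mid S}(t\mid S)\geq m\}\,\log\big(\mathbb{P}_S\{P_{T\mid S}(t\mid S)\geq m\}\big)\,dm .$$ (a) For every $0\leq r\leq H(X\mid S)$, $$\max\{L_1^{r},L_2,L_3^{r}\}\leq g^{r}_{0}(P_{S,X,T})\leq \min\{H(T\mid X)+r,\ H(T\mid S),\ U_0\},$$ where, with $\alpha=\frac{r}{H(X\mid S)}$, $L_1^{r} = H(T\mid X,S)+r-H(X,S\mid T)$, $L_2 = H(T\mid X,S)-\big(\log(I(X,S;T)+5.51)+1.06\big)$, $L_3^{r} = H(T\mid X,S)+r-\alpha H(X,S\mid T)-1.06-\log\big((1-\alpha)I(X,S;T)+\alpha\min\{H(T),H(X,S)\}+5.51\big)$. (b) For every $H(X\mid S)\leq r< H(X)$, $$\max\{{L'}_1^{r},L_2\}\leq g^{r}_{0}(P_{S,X,T})\leq \min\{H(T\mid X)+r,\ H(T\mid S),\ U_0\},$$ where ${L'}_1^{r}=H(T\mid S)-H(S\mid T)=H(T)-H(S)$.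
   Context: $S$ (sensitive attribute) takes values in a finite alphabet $\mathcal{S}$; $X$ (useful data) and $T$ (task) take values in finite or countably infinite alphabets $\mathcal{X},\mathcal{T}$, with finite entropies. The supremum is over all conditional distributions $P_{Y\mid S,X,T}$ of a discrete random variable $Y$ (the representation) given $(S,X,T)$. $\mathbb{P}_S$ denotes probability with respect to $S\sim P_S$, and $P_{T\mid S}(t\mid S)$ is the conditional pmf of $T$ evaluated at the random $S$. Logarithms are base 2. *)

(* Defs.v *)
From HB Require Import structures.
From mathcomp Require Import all_boot all_order all_algebra.
From mathcomp Require Import all_classical all_reals all_analysis.
Set Implicit Arguments. Unset Strict Implicit. Unset Printing Implicit Defensive.
Import Order.TTheory GRing.Theory Num.Theory.
Local Open Scope classical_set_scope.
Local Open Scope ring_scope.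

Section Info.
Variable R : realType.

Definition log2 (x : R) : R := ln x / ln 2.

Variable Om : choiceType.

Definition is_pmf (P : Om -> R) : Prop :=
  (forall w, 0 <= P w) /\ \esum_(w in [set: Om]) (P w)%:E = 1%E.

Definition dist (P : Om -> R) (B : choiceType) (f : Om -> B) (b : B) : R :=
  fine (\esum_(w in f @^-1` [set b]) (P w)%:E).

(* Shannon entropy H(f) (base 2), a sum of nonnegative terms, in [0, +oo] *)
Definition ent (P : Om -> R) (B : choiceType) (f : Om -> B) : \bar R :=
  \esum_(b in [set: B]) (- dist P f b * log2 (dist P f b))%:E.

Definition cent (P : Om -> R) (A B : choiceType) (f : Om -> A) (g : Om -> B)
  : \bar R :=
  \esum_(ab in [set: A * B])
    (dist P (fun w => (f w, g w)) ab *
     log2 (dist P g ab.2 / dist P (fun w => (f w, g w)) ab))%:E.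

(* Mutual information I(f; g) = H(f) - H(f | g)
   (used only when H(f) is finite) *)
Definition mi (P : Om -> R) (A B : choiceType) (f : Om -> A) (g : Om -> B)
  : \bar R := (ent P f - cent P f g)%E.

End Info.

Section Model.
Variables (R : realType) (S : finType) (X T : countType).

Notation Om := ((S * X * T)%type : choiceType).
Notation Om' := (((S * X * T) * nat)%type : choiceType).

Definition vS (w : Om) : S := w.1.1.
Definition vX (w : Om) : X := w.1.2.
Definition vT (w : Om) : T := w.2.
Definition vXS (w : Om) : X * S := (w.1.2, w.1.1).

(* a conditional distribution P_{Y | S,X,T}, Y taking values in nat
   (any countable alphabet) *)
Definition is_kernel (q : Om -> nat -> R) : Prop :=
  (forall w y, 0 <= q w y) /\
  (forall w, \esum_(y in [set: nat]) (q w y)%:E = 1%E).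

Definition joint (P : Om -> R) (q : Om -> nat -> R) (w : Om') : R :=
  P w.1 * q w.1 w.2.

Definition wS (w : Om') : S := w.1.1.1.
Definition wX (w : Om') : X := w.1.1.2.
Definition wT (w : Om') : T := w.1.2.
Definition wY (w : Om') : nat := w.2.

Definition g0 (r : R) (P : Om -> R) : \bar R :=
  ereal_sup [set v | exists q, is_kernel q /\
     mi (joint P q) wS wY = 0%E /\
     (mi (joint P q) wX wY <= r%:E)%E /\
     v = mi (joint P q) wT wY].

Definition pS (P : Om -> R) (s : S) : R := dist P vS s.
Definition pTgS (P : Om -> R) (t : T) (s : S) : R :=
  dist P (fun w => (vS w, vT w)) (s, t) / pS P s.

Definition phi (P : Om -> R) (t : T) (m : R) : R :=
  \sum_(s : S | m <= pTgS P t s) pS P s.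

(* U_0 = H(T) + sum_t int_0^1 phi log phi dm  (written with the nonnegative
   integrand - phi log phi) *)
Definition U0 (P : Om -> R) : \bar R :=
  (ent P vT - \esum_(t in [set: T])
     \int[lebesgue_measure]_(m in `[0%R, 1%R])
        (- phi P t m * log2 (phi P t m))%:E)%E.

End Model.

(* Main.v *)
Require Import Defs.
From HB Require Import structures.
From mathcomp Require Import all_boot all_order all_algebra.
From mathcomp Require Import all_classical all_reals all_analysis.
From mathcomp Require Import ring lra.
Import Order.TTheory GRing.Theory Num.Theory.
Local Open Scope classical_set_scope.
Local Open Scope ring_scope.

(* Upper bounds. For [H(T|X) + r] and [H(T|S)], bound [I(T;Y)] by [I(T;X,Y) = I(X;Y) + I(T;Y|X)], and
   likewise with [S]. For [U_0], fix [t]: as [Y] is independent of [S], the posteriors [P(t|s,Y)] have mean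
   [P(t|s)], and by concavity of [h(x) = - x log x] the mean of [h(P(t|Y))] is smallest when they are the
   comonotone indicators [U <= P(t|s)], [U] uniform; the comparison goes through the Lovasz extension of
   [A |-> h(P_S(A))].

   Lower bounds. Given a pair [(A,B)], give each outcome [b] an independent (discretised) exponential clock
   [E_b] and let [a] select the [b] that minimises [E_b / P(b|a)]: the clocks [Y] are independent of [A] and
   determine [B] from [A]. Coding [B] given the clocks by the law of the selected outcome gives
   [H(B|Y) <= H(A)]. Coding [b] with weight [phi(tau_b)], [tau_b = E_b / P(b)], [phi(x) = (k + x)^(-1-s)],
   gives [H(B|Y) <= I(A;B) + log(I(A;B) + 5.51) + 1.06], because the total weight is on average at most the
   integral of [phi], while the mean of [tau_b] given that [a] selects [b] is [P(b|a) / P(b)].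
   With [A = (X,S)] and [B = T] this settles [r = 0]; with [A = S] and [B = (X,T)] it settles [r = H(X|S)];
   time sharing between the two covers the intermediate [r]. *)
Set Implicit Arguments. Unset Strict Implicit. Unset Printing Implicit Defensive.

(** * Sums of nonnegative families *)

(** A kernel takes values in [nat], so exponential clocks cannot themselves be [Y]. They become
    finitely many truncated geometric clocks, run for finitely many rounds. Ties, rounding of the
    rates, outcomes without a clock and exhausted rounds leave some probability undecided. The
    discretisation keeps each selection probability at most [p (a, b)], so a residual law can
    restore the missing mass without disturbing the law of [(a, b)] or the independence of [a] and
    the clocks. The cost of coding that mass may be unbounded in [b], hence the deficit is
    controlled against an arbitrary cost [u] of finite mean, not only in total. Every lower bound
    thus holds up to [eps], which the supremum absorbs. Entropies are extended-real sums that split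
    only for nonnegative terms. This dictates the form of many inequalities: negative terms are
    carried to the other side, or a common constant is added to both sides and cancelled once it is
    known to be finite. *)

Section Tot.
Variable R : realType.
Implicit Types I J : choiceType.

Definition tot I (F : I -> R) : \bar R := \esum_(i in [set: I]) (F i)%:E.

Lemma eq_tot I (F G : I -> R) : F =1 G -> tot F = tot G.
Proof. by move=> FG; apply: eq_esum => i _; rewrite FG. Qed.

Lemma le_tot I (F G : I -> R) : (forall i, F i <= G i) -> (tot F <= tot G)%E.
Proof. by move=> FG; apply: le_esum => i _; rewrite lee_fin. Qed.

Lemma tot_ge0 I (F : I -> R) : (forall i, 0 <= F i) -> (0 <= tot F)%E.
Proof. by move=> F0; apply: esum_ge0 => i _; rewrite lee_fin. Qed.

Lemma tot0 I : tot (fun _ : I => 0 : R) = 0%E.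
Proof. by apply: esum1. Qed.

Lemma totD I (F G : I -> R) : (forall i, 0 <= F i) -> (forall i, 0 <= G i) ->
  tot (fun i => F i + G i) = (tot F + tot G)%E.
Proof.
move=> F0 G0; rewrite /tot -esumD; first by apply: eq_esum => i _; rewrite EFinD.
all: by move=> i _; rewrite lee_fin.
Qed.

Lemma esumZ I (c : R) (F : I -> \bar R) : 0 <= c -> (forall i, 0 <= F i)%E ->
  \esum_(i in [set: I]) (c%:E * F i)%E = (c%:E * \esum_(i in [set: I]) F i)%E.
Proof.
move=> c0 F0; have [->|cn0] := eqVneq c 0.
  by rewrite mul0e esum1// => i _; rewrite mul0e.
(* Used with [c] and with its inverse, which gives both inequalities. *)
have half k (G : I -> \bar R) : 0 < k -> (forall i, 0 <= G i)%E ->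
    (\esum_(i in [set: I]) (k%:E * G i) <= k%:E * \esum_(i in [set: I]) G i)%E.
  move=> k0 G0; apply: ge_ereal_sup => _ [A [finA AD] <-].
  rewrite -ge0_mule_fsumr//.
  by rewrite lee_pmul2l// ?lte_fin//; apply: ereal_sup_ubound; exists A.
have cp : 0 < c by rewrite lt_neqAle eq_sym cn0.
apply/eqP; rewrite eq_le half//=.
rewrite -[leRHS]mul1e -(mulfV cn0) EFinM -muleA lee_pmul2l ?lte_fin//.
apply: le_trans (half c^-1 _ _ _); rewrite ?invr_gt0//.
  by apply: le_esum => i Di; rewrite muleA -EFinM mulVf// mul1e.
by move=> i; rewrite mule_ge0.
Qed.

Lemma totZ I (c : R) (F : I -> R) : 0 <= c -> (forall i, 0 <= F i) ->
  tot (fun i => c * F i) = (c%:E * tot F)%E.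
Proof.
move=> c0 F0; rewrite /tot -esumZ//.
Qed.

Lemma tot_pair I J (F : I * J -> R) : (forall i, 0 <= F i) ->
  tot F = \esum_(i in [set: I]) tot (fun j => F (i, j)).
Proof.
move=> F0; rewrite /tot esum_esum; last by move=> i j _ _; rewrite lee_fin.
have -> : [set: I] `*`` (fun=> [set: J]) = [set: I * J] by apply/seteqP; split.
by apply: eq_esum => -[].
Qed.

Lemma tot_swap I J (F : I * J -> R) : (forall i, 0 <= F i) ->
  tot F = tot (fun k : J * I => F (k.2, k.1)).
Proof.
move=> F0; rewrite /tot.
rewrite (@reindex_esum R (J * I)%type (I * J)%type setT setT (fun k => (k.2, k.1)))//.
split => //; first by move=> [a b] [c d] _ _ [-> ->].
by move=> [a b] _; exists (b, a).
Qed.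

Lemma tot_fiber I J (f : I -> J) (F : I -> R) : (forall i, 0 <= F i) ->
  tot F = \esum_(j in [set: J]) \esum_(i in f @^-1` [set j]) (F i)%:E.
Proof.
move=> F0; rewrite esum_esum; last by move=> i j _ _; rewrite lee_fin.
rewrite /tot (@reindex_esum R I (J * I)%type setT _ (fun i => (f i, i)))//.
split => //; first by move=> a b _ _ [].
by move=> [b a] [_ /= <-]; exists a.
Qed.

Lemma tot_ge I (F : I -> R) i : (forall i, 0 <= F i) -> ((F i)%:E <= tot F)%E.
Proof.
move=> F0; apply: esum_ge; exists [set i]; first by split.
by rewrite fsbig_set1.
Qed.

Lemma tot_seq I (r : seq I) (F : I -> R) : uniq r -> (forall i, 0 <= F i) ->
  (forall i, i \notin r -> F i = 0) -> tot F = (\sum_(i <- r) F i)%:E.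
Proof.
move=> ur F0 Fr; transitivity (\esum_(i in [set` r]) (F i)%:E).
  rewrite [RHS]esum_mkcond; apply: eq_esum => i _.
  by case: ifPn => //; rewrite notin_setE /= => /negP /Fr ->.
rewrite esum_fset//; last by move=> i _; rewrite lee_fin.
by rewrite -fsbig_seq// sumEFin.
Qed.

Lemma tot_fin (I : finType) (F : I -> R) : (forall i, 0 <= F i) ->
  tot F = (\sum_i F i)%:E.
Proof.
move=> F0; rewrite (@tot_seq _ (index_enum I))// ?index_enum_uniq// => i.
by rewrite mem_index_enum.
Qed.

Lemma tot_esum I (D : set I) (F : I -> R) : 
  \esum_(i in D) (F i)%:E = tot (fun i => (i \in D)%:R * F i).
Proof.
rewrite esum_mkcond; apply: eq_esum => i _.
by case: ifP; rewrite ?mul1r ?mul0r.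
Qed.

End Tot.

(** * Entropies on a countable space *)

Section Log2.
Variable R : realType.
Implicit Types x y : R.

Lemma ln2_gt0 : 0 < ln 2 :> R.
Proof. by apply: ln_gt0; rewrite ltr1n. Qed.

Lemma log2V x : 0 < x -> log2 x^-1 = - log2 x.
Proof. by move=> x0; rewrite /log2 lnV ?posrE// mulNr. Qed.

Lemma log2M x y : 0 < x -> 0 < y -> log2 (x * y) = log2 x + log2 y.
Proof. by move=> x0 y0; rewrite /log2 lnM ?posrE// mulrDl. Qed.

Lemma log2_div x y : 0 < x -> 0 < y -> log2 (x / y) = log2 x - log2 y.
Proof. by move=> x0 y0; rewrite log2M ?invr_gt0// log2V. Qed.

Lemma log2_le x y : 0 < x -> x <= y -> log2 x <= log2 y.
Proof.
move=> x0 xy; rewrite /log2 ler_pM2r ?invr_gt0 ?ln2_gt0//.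
by rewrite ler_ln ?posrE// (lt_le_trans x0).
Qed.

Lemma log2_ge0 x : 1 <= x -> 0 <= log2 x.
Proof. by move=> x1; apply: divr_ge0; [exact: ln_ge0|exact/ltW/ln2_gt0]. Qed.

Lemma log2_le0 x : x <= 1 -> log2 x <= 0.
Proof.
move=> x1; rewrite /log2 pmulr_lle0; first exact: ln_le0.
by rewrite invr_gt0; exact: ln2_gt0.
Qed.

Lemma ln_le_subr1 x : 0 < x -> ln x <= x - 1.
Proof. by move=> x0; rewrite -{1}[x](subrKC 1) le_ln1Dx// ltrBrDl subrr. Qed.

Lemma log2_le_subr1 x : 0 < x -> log2 x <= (x - 1) / ln 2.
Proof. by move=> x0; rewrite /log2 ler_pM2r ?invr_gt0 ?ln2_gt0// ln_le_subr1. Qed.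

Lemma ln_eq_subr1 x : 0 < x -> ln x = x - 1 -> x = 1.
Proof.
move=> x0 E; apply/eqP; rewrite -subr_eq0; apply/negPn/negP => /expR_gt1Dx.
by rewrite -E lnK ?posrE// E subrKC ltxx.
Qed.

End Log2.

Lemma mem_fiber (A B : choiceType) (f : A -> B) a b :
  (a \in f @^-1` [set b]) = (f a == b).
Proof. by apply/idP/eqP; rewrite inE. Qed.

Section Dist.
Variables (R : realType) (Om : choiceType) (P : Om -> R).
Hypothesis hP : is_pmf P.
Implicit Types A B C : choiceType.

Let P0 w : 0 <= P w. Proof. by case: hP. Qed.
Let P1 : tot P = 1%E. Proof. by case: hP. Qed.
Hint Resolve P0 : core.

Lemma distE B (f : Om -> B) b :
  (dist P f b)%:E = tot (fun w => (f w == b)%:R * P w).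
Proof.
have E : \esum_(w in f @^-1` [set b]) (P w)%:E =
    tot (fun w => (f w == b)%:R * P w).
  by rewrite tot_esum; apply: eq_tot => w; rewrite mem_fiber.
rewrite /dist E fineK// ge0_fin_numE; last first.
  by apply: tot_ge0 => w; rewrite mulr_ge0.
apply: (@le_lt_trans _ _ 1%E); last exact: ltry.
rewrite -P1; apply: le_tot => w; by case: eqP; rewrite ?mul1r ?mul0r.
Qed.

Lemma dist_ge0 B (f : Om -> B) b : 0 <= dist P f b.
Proof. by rewrite -lee_fin distE; apply: tot_ge0 => w; rewrite mulr_ge0. Qed.

Lemma dist_mono A B (f : Om -> A) (g : Om -> B) a b :
  (forall w, f w = a -> g w = b) -> dist P f a <= dist P g b.
Proof.
move=> fg; rewrite -lee_fin !distE; apply: le_tot => w.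
rewrite ler_wpM2r// ler_nat; case: eqP => // /fg ->; by rewrite eqxx.
Qed.

Lemma dist_le1 B (f : Om -> B) b : dist P f b <= 1.
Proof.
rewrite -lee_fin -P1 distE; apply: le_tot => w.
by case: eqP; rewrite ?mul1r ?mul0r.
Qed.

Lemma dist_gt0 B (f : Om -> B) w : 0 < P w -> 0 < dist P f (f w).
Proof.
move=> Pw; apply: (lt_le_trans Pw); rewrite -lee_fin distE.
apply: le_trans (tot_ge w _); first by rewrite eqxx mul1r.
by move=> v; rewrite mulr_ge0.
Qed.

Lemma dist_E B (f : Om -> B) (g : B -> R) : (forall b, 0 <= g b) ->
  tot (fun b => dist P f b * g b) = tot (fun w => P w * g (f w)).
Proof.
move=> g0; rewrite (tot_fiber f); last by move=> w; rewrite mulr_ge0.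
apply: eq_esum => b _; rewrite tot_esum mulrC EFinM distE -totZ//; last first.
  by move=> w; rewrite mulr_ge0.
apply: eq_tot => w; rewrite mem_fiber.
by case: eqP => [->|]; rewrite ?mul1r ?mul0r ?mulr0// mulrC.
Qed.

Lemma dist_pmf B (f : Om -> B) : is_pmf (dist P f).
Proof.
split; first exact: dist_ge0.
rewrite -[RHS]P1; transitivity (tot (fun b => dist P f b * 1)).
  by apply: eq_tot => b; rewrite mulr1.
by rewrite dist_E//; apply: eq_tot => b; rewrite mulr1.
Qed.

Lemma tot_dist B (f : Om -> B) : tot (dist P f) = 1%E.
Proof. by have [] := dist_pmf f. Qed.

Lemma dist_comp A B (f : Om -> A) (g : A -> B) b :
  dist (dist P f) g b = dist P (fun w => g (f w)) b.
Proof.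
apply: EFin_inj; rewrite distE// /dist.
have [d0 d1] := dist_pmf f.
rewrite fineK; last first.
  rewrite ge0_fin_numE; last by apply: esum_ge0 => a _; rewrite lee_fin dist_ge0.
  apply: (@le_lt_trans _ _ 1%E); last exact: ltry.
  rewrite -d1 tot_esum; apply: le_tot => a.
  by case: (_ \in _); rewrite ?mul1r ?mul0r.
rewrite tot_esum.
transitivity (tot (fun a => dist P f a * (g a == b)%:R)).
  by apply: eq_tot => a; rewrite mem_fiber mulrC.
rewrite dist_E; last by move=> a; rewrite ler0n.
by apply: eq_tot => w; rewrite mulrC.
Qed.

Lemma dist_margin A B (f : Om -> A) (g : Om -> B) b :
  (dist P g b)%:E = tot (fun a => dist P (fun w => (f w, g w)) (a, b)).
Proof.
rewrite distE (tot_fiber f); last by move=> w; rewrite mulr_ge0.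
apply: eq_esum => a _; rewrite distE tot_esum; apply: eq_tot => w; rewrite mem_fiber.
by rewrite xpair_eqE; case: eqP; rewrite ?mul1r ?mul0r.
Qed.

Lemma dist_swap A B (f : Om -> A) (g : Om -> B) a b :
  dist P (fun w => (f w, g w)) (a, b) = dist P (fun w => (g w, f w)) (b, a).
Proof.
by apply/eqP; rewrite eq_le !dist_mono// => w [-> ->].
Qed.

(** Written as means over the sample space, entropies of different variables can be compared
    pointwise; terms with [P w = 0] vanish, so logarithms are met only at positive arguments. *)
Lemma ent_tot B (f : Om -> B) :
  ent P f = tot (fun w => P w * - log2 (dist P f (f w))).
Proof.
rewrite /ent -(@dist_E _ f (fun b => - log2 (dist P f b))); last first.
  by move=> b; rewrite oppr_ge0 log2_le0// dist_le1.
by apply: eq_esum => b _; rewrite mulNr mulrN.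
Qed.

(** Null events are covered by the conventions [x / 0 = 0] and [ln 0 = 0], so the terms of a
    conditional entropy are nonnegative everywhere. *)
Lemma log2_ratio_ge0 A B (f : Om -> A) (g : Om -> B) a b :
  (forall w, g w = b -> f w = a) -> 0 <= log2 (dist P f a / dist P g b).
Proof.
move=> gf; have := dist_ge0 g b; rewrite le_eqVlt => /orP[/eqP<-|d0].
  by rewrite invr0 mulr0 /log2 ln0// mul0r.
by rewrite log2_ge0// ler_pdivlMr// mul1r dist_mono.
Qed.

Lemma cent_tot A B (f : Om -> A) (g : Om -> B) :
  cent P f g = tot (fun w => P w *
    log2 (dist P g (g w) / dist P (fun w => (f w, g w)) (f w, g w))).
Proof.
rewrite /cent -[LHS]/(tot _) (@dist_E _ (fun w => (f w, g w))
  (fun ab => log2 (dist P g ab.2 / dist P (fun w => (f w, g w)) ab)))//.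
by move=> [a b]; apply: log2_ratio_ge0 => w [].
Qed.

Lemma ent_ge0 B (f : Om -> B) : (0 <= ent P f)%E.
Proof.
rewrite ent_tot; apply: tot_ge0 => w.
by rewrite mulr_ge0// oppr_ge0 log2_le0// dist_le1.
Qed.

Lemma cent_ge0 A B (f : Om -> A) (g : Om -> B) : (0 <= cent P f g)%E.
Proof.
rewrite cent_tot; apply: tot_ge0 => w.
by rewrite mulr_ge0//; apply: log2_ratio_ge0 => v [].
Qed.

(* [ln x <= x - 1] is used at [x = q / d], summed against [d]. *)
Lemma gibbs C (h : Om -> C) (q : C -> R) (G H : Om -> R) :
  (forall c, 0 <= q c) -> (tot q <= 1)%E ->
  (forall w, 0 <= G w) -> (forall w, 0 <= H w) ->
  (forall w, 0 < P w -> 0 < q (h w) /\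
     G w <= H w + log2 (q (h w) / dist P h (h w))) ->
  (tot (fun w => P w * G w)%R <= tot (fun w => P w * H w)%R)%E.
Proof.
move=> q0 q1 G0 H0 GH.
pose k : R := (ln 2)^-1.
have k0 : 0 <= k by rewrite invr_ge0; exact/ltW/ln2_gt0.
pose r w := q (h w) / dist P h (h w).
have r0 w : 0 <= r w by rewrite divr_ge0// dist_ge0.
have tr : (tot (fun w => P w * r w)%R <= 1)%E.
  apply: le_trans q1; rewrite -(@dist_E _ h (fun c => q c / dist P h c)).
    apply: le_tot => c; have := dist_ge0 h c.
    rewrite le_eqVlt => /orP[/eqP<-|d0]; first by rewrite mul0r.
    by rewrite mulrCA mulfV ?gt_eqF// mulr1.
  by move=> c; rewrite divr_ge0// dist_ge0.
(* The [-1] of [ln x <= x - 1] is moved to the left as [k * P w], which keeps all summands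
   nonnegative; its total [k] is finite and is cancelled at the end. *)
have key : (tot (fun w => P w * G w + k * P w)%R <=
            tot (fun w => P w * H w + k * (P w * r w))%R)%E.
  apply: le_tot => w; have := P0 w; rewrite le_eqVlt => /orP[/eqP<-|Pw].
    by rewrite !mul0r.
  have [qw Gw] := GH w Pw.
  rewrite mulrCA [k * P w]mulrC -!mulrDr ler_wpM2l//.
  have := log2_le_subr1 (divr_gt0 qw (dist_gt0 h Pw)).
  by rewrite -/(r w) -/k => ?; lra.
have PF0 F : (forall w, 0 <= F w) -> forall w, 0 <= P w * F w.
  by move=> F0 w; rewrite mulr_ge0.
have kF0 F : (forall w, 0 <= F w) -> forall w : Om, 0 <= k * F w.
  by move=> F0 w; rewrite mulr_ge0.
move: key; rewrite (totD (PF0 _ G0) (kF0 _ P0)).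
rewrite (totD (PF0 _ H0) (kF0 _ (PF0 _ r0))).
rewrite (totZ k0 P0) (totZ k0 (PF0 _ r0)) P1 mule1 => key.
rewrite -(@leeD2rE _ k%:E)//; apply: (le_trans key); rewrite leeD2l//.
by rewrite -[leRHS]mule1 lee_wpmul2l.
Qed.

Lemma tot_dist_prod A B (f : Om -> A) (g : Om -> B) :
  tot (fun ab => dist P f ab.1 * dist P g ab.2) = 1%E.
Proof.
rewrite tot_pair; last by move=> c; rewrite mulr_ge0// dist_ge0.
rewrite -(tot_dist f); apply: eq_esum => a _; rewrite /=.
rewrite totZ; [|exact: dist_ge0|exact: dist_ge0].
by rewrite tot_dist mule1.
Qed.

Lemma cent_le_ent A B (f : Om -> A) (g : Om -> B) : (cent P f g <= ent P f)%E.
Proof.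
rewrite cent_tot ent_tot.
apply: (@gibbs _ (fun w => (f w, g w)) (fun ab => dist P f ab.1 * dist P g ab.2)).
- by move=> c; rewrite mulr_ge0// dist_ge0.
- by rewrite tot_dist_prod.
- by move=> w; apply: log2_ratio_ge0 => v [].
- by move=> w; rewrite oppr_ge0 log2_le0// dist_le1.
- move=> w Pw /=.
  have fp := dist_gt0 f Pw; have gp := dist_gt0 g Pw.
  have fgp := dist_gt0 (fun w => (f w, g w)) Pw.
  split; first exact: mulr_gt0.
  by rewrite !log2_div ?log2M ?mulr_gt0//; lra.
Qed.

(* Equality in Gibbs' inequality: each [q - d - d ln (q / d) >= 0] must vanish. *)
Lemma mi_eq0_indep A B (f : Om -> A) (g : Om -> B) a b :
  (ent P f < +oo)%E -> mi P f g = 0%E ->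
  dist P (fun w => (f w, g w)) (a, b) = dist P f a * dist P g b.
Proof.
move=> Hf mi0.
have Hff : ent P f \is a fin_num by rewrite ge0_fin_numE ?ent_ge0.
have Hcf : cent P f g \is a fin_num.
  by rewrite ge0_fin_numE ?cent_ge0// (le_lt_trans (cent_le_ent f g)).
have ce : cent P f g = ent P f.
  by move: mi0; rewrite /mi => /eqP; rewrite sube_eq// ?add0e ?fin_num_adde_defl// => /eqP.
pose k : R := (ln 2)^-1.
have k0 : 0 < k by rewrite invr_gt0; exact: ln2_gt0.
pose d := dist P (fun w => (f w, g w)).
pose q (c : A * B) := dist P f c.1 * dist P g c.2.
pose sl c := q c - d c - d c * ln (q c / d c).
have d0 c : 0 <= d c by exact: dist_ge0.
have q0 c : 0 <= q c by rewrite mulr_ge0// dist_ge0.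
have dq c : 0 < d c -> 0 < dist P f c.1 /\ 0 < dist P g c.2.
  case: c => a' b' dc; split; apply: (lt_le_trans dc); by apply: dist_mono => w [].
have sl0 c : 0 <= sl c.
  have := d0 c; rewrite /sl le_eqVlt => /orP[/eqP<-|dc].
    by rewrite mul0r !subr0.
  have [fp gp] := dq c dc.
  have := ln_le_subr1 (divr_gt0 (mulr_gt0 fp gp) dc).
  rewrite -(ler_pM2l dc) mulrBr mulr1 mulrCA divff ?gt_eqF// mulr1 -/(q c).
  lra.
pose lf (c : A * B) := - log2 (dist P f c.1).
have lf0 c : 0 <= lf c by rewrite oppr_ge0 log2_le0// dist_le1.
pose lg (c : A * B) := log2 (dist P g c.2 / d c).
have lg0 c : 0 <= lg c by case: c => a' b'; apply: log2_ratio_ge0 => w [].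
have E1 : ent P f = tot (fun c => d c * lf c).
  by rewrite ent_tot (@dist_E _ (fun w => (f w, g w)) lf).
have E2 : cent P f g = tot (fun c => d c * lg c).
  by rewrite cent_tot (@dist_E _ (fun w => (f w, g w)) lg).
have key : tot (fun c => (d c * lg c + k * sl c) + k * d c) =
           tot (fun c => d c * lf c + k * q c).
  apply: eq_tot => c; have := d0 c; rewrite /sl le_eqVlt => /orP[/eqP<-|dc].
    by rewrite !mul0r mulr0 addr0 add0r !subr0 add0r.
  have [fp gp] := dq c dc.
  rewrite /lg /lf log2_div// /log2 -/k ln_div ?posrE ?mulr_gt0// lnM ?posrE//.
  by rewrite -/k; lra.
have dl0 c : 0 <= d c * lg c by rewrite mulr_ge0.
have ks0 c : 0 <= k * sl c by rewrite mulr_ge0// ltW.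
have kd0 c : 0 <= k * d c by rewrite mulr_ge0// ltW.
have kq0 c : 0 <= k * q c by rewrite mulr_ge0// ltW.
move: key; rewrite totD//; last by move=> c; rewrite addr_ge0.
rewrite totD// totD//; last by move=> c; rewrite mulr_ge0.
rewrite -E1 -E2 (totZ (ltW k0) q0) (totZ (ltW k0) d0) (totZ (ltW k0) sl0).
rewrite tot_dist_prod tot_dist mule1 ce => /eqP.
have Sge := tot_ge0 sl0.
move: Hff Sge; case: (ent P f) => [e||]// _.
case: (tot sl) (tot_ge (a, b) sl0) => [x|_ _|]//; last first.
  by rewrite gt0_muley// ?lte_fin.
rewrite !lee_fin -EFinM -!EFinD eqe => slx x0 /eqP kx.
have x00 : x = 0.
  have /eqP : k * x = 0 by lra.
  by rewrite mulf_eq0 gt_eqF//= => /eqP.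
have sab : sl (a, b) = 0 by apply/eqP; rewrite eq_le sl0 andbT -x00.
rewrite -/d; have := d0 (a, b); rewrite le_eqVlt => /orP[/eqP dz|dc].
  by move: sab; rewrite /sl -dz mul0r !subr0.
have [fp gp] := dq _ dc.
have qd : ln (q (a, b) / d (a, b)) = q (a, b) / d (a, b) - 1.
  apply: (mulfI (lt0r_neq0 dc)); rewrite mulrBr mulr1 mulrCA divff ?gt_eqF//.
  by move: sab; rewrite /sl; lra.
have := ln_eq_subr1 (divr_gt0 (mulr_gt0 fp gp) dc) qd.
by move/(congr1 ( *%R^~ (d (a, b)))); rewrite divfK ?gt_eqF// mul1r.
Qed.

Lemma chain_rule A B (f : Om -> A) (g : Om -> B) :
  ent P (fun w => (f w, g w)) = (cent P f g + ent P g)%E.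
Proof.
rewrite cent_tot !ent_tot -totD; last 2 first.
- by move=> w; rewrite mulr_ge0//; apply: log2_ratio_ge0 => v [].
- by move=> w; rewrite mulr_ge0// oppr_ge0 log2_le0// dist_le1.
apply: eq_tot => w; rewrite -mulrDr.
have := P0 w; rewrite le_eqVlt => /orP[/eqP<-|Pw]; first by rewrite !mul0r.
have gp := dist_gt0 g Pw; have fgp := dist_gt0 (fun w => (f w, g w)) Pw.
by rewrite log2_div//; congr (_ * _); lra.
Qed.

Lemma ent_swap A B (f : Om -> A) (g : Om -> B) :
  ent P (fun w => (f w, g w)) = ent P (fun w => (g w, f w)).
Proof. by rewrite !ent_tot; apply: eq_tot => w; rewrite dist_swap. Qed.

Lemma cent_mono A B C (f : Om -> A) (f' : Om -> B) (g : Om -> C) (u : B -> A) :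
  (forall w, f w = u (f' w)) -> (cent P f g <= cent P f' g)%E.
Proof.
move=> fu; rewrite !cent_tot; apply: le_tot => w.
have := P0 w; rewrite le_eqVlt => /orP[/eqP<-|Pw]; first by rewrite !mul0r.
have fgp := dist_gt0 (fun w => (f w, g w)) Pw.
have fgp' := dist_gt0 (fun w => (f' w, g w)) Pw.
rewrite ler_wpM2l// log2_le//; first by rewrite divr_gt0 ?(dist_gt0 g Pw).
rewrite ler_wpM2l ?dist_ge0// lef_pV2 ?posrE//.
by apply: dist_mono => v [e ->]; rewrite !fu e.
Qed.

(* The Gibbs weight makes [f] conditionally coupled to [Y] and [g] independently given [f]. *)
Lemma ent_exchange A B C (f : Om -> A) (g : Om -> B) (Y : Om -> C) :
  (ent P f + cent P g Y <= cent P f Y + (ent P g + cent P f g))%E.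
Proof.
have le0 A' (h : Om -> A') w : 0 <= - log2 (dist P h (h w)).
  by rewrite oppr_ge0 log2_le0// dist_le1.
have cc A' B' (h : Om -> A') (k : Om -> B') w :
  0 <= log2 (dist P k (k w) / dist P (fun w => (h w, k w)) (h w, k w)).
  by apply: log2_ratio_ge0 => v [].
have Pcc A' B' (h : Om -> A') (k : Om -> B') w := mulr_ge0 (P0 w) (cc _ _ h k w).
have Ple0 A' (h : Om -> A') w := mulr_ge0 (P0 w) (le0 _ h w).
rewrite !cent_tot !ent_tot -(totD (Ple0 _ f) (Pcc _ _ g Y)).
rewrite -(totD (Ple0 _ g) (Pcc _ _ f g)) -(totD (Pcc _ _ f Y)); last first.
  by move=> w; rewrite addr_ge0.
under eq_tot do rewrite -mulrDr.
under [leRHS]eq_tot do rewrite -!mulrDr.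
pose q (c : A * B * C) := dist P (fun w => (f w, Y w)) (c.1.1, c.2) *
  (dist P (fun w => (f w, g w)) c.1 / dist P f c.1.1).
apply: (@gibbs _ (fun w => (f w, g w, Y w)) q).
- by move=> c; rewrite !mulr_ge0 ?invr_ge0 ?dist_ge0.
- have q0 c : 0 <= q c by rewrite !mulr_ge0 ?invr_ge0 ?dist_ge0.
  rewrite tot_pair//.
  have E ab : tot (fun c => q (ab, c)) =
      (dist P (fun w => (f w, g w)) ab / dist P f ab.1 * dist P f ab.1)%:E.
    rewrite /q /=; under eq_tot do rewrite mulrC.
    rewrite totZ ?divr_ge0 ?dist_ge0//; last by move=> c; exact: dist_ge0.
    rewrite [RHS]EFinM (dist_margin Y f); congr (_ * _)%E.
    by apply: eq_tot => c; rewrite dist_swap.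
  rewrite -(tot_dist (fun w => (f w, g w))); apply: le_esum => ab _.
  rewrite E lee_fin; have := dist_ge0 f ab.1.
  rewrite le_eqVlt => /orP[/eqP<-|d0]; first by rewrite mulr0 dist_ge0.
  by rewrite divfK ?gt_eqF.
- by move=> w; rewrite addr_ge0.
- by move=> w; rewrite !addr_ge0.
move=> w Pw; rewrite /q /=.
have fp := dist_gt0 f Pw; have gp := dist_gt0 g Pw; have yp := dist_gt0 Y Pw.
have fgp := dist_gt0 (fun w => (f w, g w)) Pw.
have fyp := dist_gt0 (fun w => (f w, Y w)) Pw.
have gyp := dist_gt0 (fun w => (g w, Y w)) Pw.
have fgyp := dist_gt0 (fun w => (f w, g w, Y w)) Pw.
split; first by rewrite mulr_gt0// divr_gt0.
rewrite !log2_div ?mulr_gt0 ?log2M ?log2_div ?divr_gt0// ?invr_gt0// log2V//.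
(* Gibbs' inequality supplies submodularity of entropy at [f]; what remains is monotonicity,
   [H(g,Y) <= H(f,g,Y)], spent pointwise. *)
have : log2 (dist P (fun w => (f w, g w, Y w)) (f w, g w, Y w)) <=
       log2 (dist P (fun w => (g w, Y w)) (g w, Y w)).
  by apply: log2_le => //; apply: dist_mono => v [_ -> ->].
lra.
Qed.

End Dist.

(** * Upper bounds *)

Section Kernel.
Variables (R : realType) (Om : choiceType) (P : Om -> R) (q : Om -> nat -> R).
Hypothesis hP : is_pmf P.
Hypothesis hq : (forall w y, 0 <= q w y) /\
  (forall w, \esum_(y in [set: nat]) (q w y)%:E = 1%E).

Implicit Types A B : choiceType.

Let J (w : Om * nat) : R := P w.1 * q w.1 w.2.

Lemma kernel_pmf : is_pmf J.
Proof.
have [P0 P1] := hP; have [q0 q1] := hq; have J0 w : 0 <= J w by rewrite mulr_ge0.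
split=> //; rewrite -[LHS]/(tot J) tot_pair// -P1; apply: eq_esum => w _.
by rewrite /J /= totZ// /tot q1 mule1.
Qed.

Lemma dist_kernel_fst B (f : Om -> B) : dist J (fun w => f w.1) = dist P f.
Proof.
apply/funext => b; rewrite -(dist_comp kernel_pmf fst); congr (dist _ f b).
have [P0 P1] := hP; have [q0 q1] := hq; have J0 w : 0 <= J w by rewrite mulr_ge0.
apply/funext => w; apply: EFin_inj; rewrite (distE kernel_pmf) tot_pair; last first.
  by move=> c; rewrite mulr_ge0.
rewrite (_ : (fun v => _) = (fun v => ((v == w)%:R * P v)%:E)); last first.
  apply/funext => v; rewrite /J /=; under eq_tot do rewrite mulrA.
  by rewrite totZ ?mulr_ge0// /tot q1 mule1.
rewrite -[LHS]/(tot (fun v => (v == w)%:R * P v)) (@tot_seq _ _ [:: w])//.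
- by rewrite big_seq1 eqxx mul1r.
- by move=> v; rewrite mulr_ge0.
- by move=> v; rewrite inE => /negPf ->; rewrite mul0r.
Qed.

Lemma ent_kernel_fst B (f : Om -> B) : ent J (fun w => f w.1) = ent P f.
Proof. by rewrite /ent dist_kernel_fst. Qed.

Lemma cent_kernel_fst A B (f : Om -> A) (g : Om -> B) :
  cent J (fun w => f w.1) (fun w => g w.1) = cent P f g.
Proof.
rewrite /cent dist_kernel_fst.
by rewrite (@dist_kernel_fst _ (fun w => (f w, g w))).
Qed.

(** This is [I(f;Y) <= I(g;Y) + H(f|g)], from [ent_exchange]. It gives the upper bounds with [g = X]
    and [g = S], and later [I(X;Y) <= H(X|S)] when [Y] is independent of [S]. *)
Lemma mi_le_cent_add A B (f : Om -> A) (g : Om -> B) (r : R) :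
  (ent P f < +oo)%E -> (ent P g < +oo)%E ->
  (mi J (fun w => g w.1) snd <= r%:E)%E ->
  (mi J (fun w => f w.1) snd <= cent P f g + r%:E)%E.
Proof.
move=> Hf Hg; have hJ := kernel_pmf.
have := ent_exchange hJ (fun w => f w.1) (fun w => g w.1) snd.
have := cent_le_ent hJ (fun w => f w.1) snd.
have := cent_le_ent hJ (fun w => g w.1) snd.
have := cent_le_ent hP f g.
have := cent_ge0 hJ (fun w => f w.1) snd.
have := cent_ge0 hJ (fun w => g w.1) snd.
have := cent_ge0 hP f g; have := ent_ge0 hP f; have := ent_ge0 hP g.
rewrite /mi cent_kernel_fst !ent_kernel_fst; move: Hf Hg.
case: (ent P f) => [a||]//; case: (ent P g) => [b||]// _ _ _ _.
case: (cent P f g) => [c||]//.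
case: (cent J (fun w => f w.1) snd) => [d||]//.
case: (cent J (fun w => g w.1) snd) => [e||]//.
rewrite -?EFinB -?EFinD !lee_fin; lra.
Qed.

End Kernel.

Section UpperBounds.
Variables (R : realType) (S : finType) (X T : countType).
Variable P : (S * X * T)%type -> R.
Hypothesis hP : is_pmf P.
Hypothesis HX : (ent P (@vX S X T) < +oo)%E.
Hypothesis HT : (ent P (@vT S X T) < +oo)%E.

Lemma ent_finType (Om : choiceType) (Q : Om -> R) (F : finType) (f : Om -> F) :
  is_pmf Q -> (ent Q f < +oo)%E.
Proof.
move=> hQ; rewrite /ent -/(tot _) tot_fin ?ltry// => b.
by rewrite mulNr -mulrN mulr_ge0 ?(dist_ge0 hQ)// oppr_ge0 log2_le0// dist_le1.
Qed.

Lemma g0_le_centX r : (g0 r P <= cent P (@vT S X T) (@vX S X T) + r%:E)%E.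
Proof.
apply: ge_ereal_sup => _ [q [hq [_ [mX ->]]]].
exact: (mi_le_cent_add hP hq (f := @vT S X T) HT HX mX).
Qed.

Lemma g0_le_centS r : (g0 r P <= cent P (@vT S X T) (@vS S X T))%E.
Proof.
apply: ge_ereal_sup => _ [q [hq [mS [_ ->]]]].
have HS : (ent P (@vS S X T) < +oo)%E by exact: ent_finType.
rewrite -[leRHS]adde0.
apply: (mi_le_cent_add hP hq (f := @vT S X T) (g := @vS S X T) HT HS).
by rewrite -[X in (X <= _)%E]/(mi (joint P q) _ _) mS.
Qed.

End UpperBounds.

(** * Concavity of [xlog] and the bound by [U0] *)

Section Concave.
Variable R : realType.
Implicit Types x y v w W : R.

Definition xlog x : R := - x * log2 x.

Lemma xlog0 : xlog 0 = 0.
Proof. by rewrite /xlog oppr0 mul0r. Qed.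

Lemma xlog_tangent x y : 0 <= x -> 0 < y ->
  xlog x <= - x * log2 y + (y - x) / ln 2.
Proof.
have k0 : 0 < (ln 2)^-1 :> R by rewrite invr_gt0; exact: ln2_gt0.
rewrite le_eqVlt => /orP[/eqP<- y0|x0 y0].
  by rewrite xlog0 oppr0 mul0r addr0 add0r mulr_ge0// ltW.
have := ln_le_subr1 (divr_gt0 y0 x0).
rewrite ln_div ?posrE// -(ler_pM2l x0) [leRHS]mulrBr mulrCA divff ?gt_eqF//.
rewrite !mulr1 -(ler_pM2r k0) /xlog /log2.
lra.
Qed.

(** Both values lie below the tangent at the mean [m]; [m = 0] is separate, as there is no tangent
    there. *)
Lemma xlog_concave (t a b : R) : 0 <= t -> t <= 1 -> 0 <= a -> 0 <= b ->
  t * xlog a + (1 - t) * xlog b <= xlog (t * a + (1 - t) * b).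
Proof.
move=> t0 t1 a0 b0; set m := t * a + _.
have u0 : 0 <= 1 - t by rewrite subr_ge0.
have m0 : 0 <= m by rewrite addr_ge0// mulr_ge0.
move: m0; rewrite le_eqVlt => /orP[/eqP m0|m0].
  have ta : t * a = 0.
    by apply/eqP; rewrite eq_le mulr_ge0// andbT m0 /m lerDl mulr_ge0.
  have ub : (1 - t) * b = 0 by move: m0; rewrite /m ta; lra.
  rewrite -m0 xlog0 /xlog !mulrA !mulrN ta ub; lra.
have A := ler_wpM2l t0 (xlog_tangent a0 m0).
have B := ler_wpM2l u0 (xlog_tangent b0 m0).
apply: (le_trans (lerD A B)); rewrite /xlog le_eqVlt; apply/orP; left; apply/eqP.
by rewrite /m; ring.
Qed.

(** Concavity acts twice: on the chord from [v] to [v + w], to pull the fraction [x] out, and to see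
    that the increment over a length [w] shrinks when its base moves from [v] up to [W]. *)
Lemma xlog_step v W w x : 0 <= v -> v <= W -> 0 <= w -> 0 <= x -> x <= 1 ->
  x * (xlog (W + w) - xlog W) <= xlog (v + w * x) - xlog v.
Proof.
move=> v0 vW w0 x0 x1.
have step1 : x * (xlog (v + w) - xlog v) <= xlog (v + w * x) - xlog v.
  have := xlog_concave x0 x1 (addr_ge0 v0 w0) v0.
  rewrite (_ : x * (v + w) + _ = v + w * x); last by ring.
  lra.
apply: le_trans step1; rewrite ler_wpM2l//.
have d0 : 0 <= W + w - v by lra.
move: d0; rewrite le_eqVlt => /orP[/eqP d0|d0].
  have -> : w = 0 by lra.
  by have -> : W = v by lra.
(* [W] and [v + w] are mirror-image convex combinations of [v] and [W + w], so the two concavity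
   bounds add up to the comparison of increments. *)
pose t := w / (W + w - v).
have t0 : 0 <= t by rewrite divr_ge0// ltW.
have t1 : t <= 1 by rewrite /t ler_pdivrMr// mul1r; lra.
have tE : t * (W + w - v) = w by rewrite /t divfK// gt_eqF.
have b0 : 0 <= W + w by lra.
have := xlog_concave t0 t1 v0 b0.
rewrite (_ : t * v + _ = W); last by move: tE; lra.
have u0 : 0 <= 1 - t by lra.
have u1 : 1 - t <= 1 by lra.
have := xlog_concave u0 u1 v0 b0.
rewrite (_ : (1 - t) * v + _ = v + w); last by move: tE; lra.
lra.
Qed.

End Concave.

Section Lovasz.
Variables (R : realType) (S : eqType) (w : S -> R).
Implicit Types (x : S -> R) (l : seq S) (v W : R).

(* For [l] sorted by decreasing [x], the Lovasz extension of the set function [A |-> xlog (sum_(s in A) w s)]. *)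
Fixpoint xlog_lovasz x l W : R :=
  if l is s :: l' then
    x s * (xlog (W + w s) - xlog W) + xlog_lovasz x l' (W + w s)
  else 0.

(** Valid for every order of [l]: [v] accumulates the mass weighted by [x] and [W] the full mass,
    and [x <= 1] preserves [v <= W], as [xlog_step] requires. *)
Lemma xlog_lovasz_le x l v W : (forall s, 0 <= w s) ->
  (forall s, 0 <= x s) -> (forall s, x s <= 1) -> 0 <= v -> v <= W ->
  xlog_lovasz x l W <= xlog (v + \sum_(s <- l) w s * x s) - xlog v.
Proof.
move=> w0 x0 x1; elim: l v W => [|s l IH] v W v0 vW /=.
  by rewrite big_nil addr0 subrr.
rewrite big_cons addrA.
have wx0 : 0 <= w s * x s by rewrite mulr_ge0.
have wx1 : w s * x s <= w s by rewrite ler_piMr.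
have := IH (v + w s * x s) (W + w s) (addr_ge0 v0 wx0) (lerD vW wx1).
have := xlog_step v0 vW (w0 s) (x0 s) (x1 s).
lra.
Qed.

(** Sortedness makes the level set of [c] an initial segment of [l], over which the increments
    telescope. *)
Lemma xlog_lovasz_level (c : S -> R) m l W : sorted (fun s t => c t <= c s) l ->
  xlog_lovasz (fun s => (m <= c s)%R%:R) l W =
  xlog (W + \sum_(s <- l | m <= c s) w s) - xlog W.
Proof.
have zero l' W' : all (fun s => c s < m) l' ->
    xlog_lovasz (fun s => (m <= c s)%R%:R) l' W' = 0.
  elim: l' W' => //= s l' IH W' /andP[sm /IH ->].
  by rewrite leNgt sm mul0r addr0.
have tr : transitive (fun s t : S => c t <= c s).
  by move=> s t u ts us; exact: le_trans us ts.
elim: l W => [|s l IH] W /=; first by rewrite big_nil addr0 subrr.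
rewrite path_sortedE// => /andP[/allP sl sol]; rewrite big_cons.
case: leP => ms; first by rewrite mul1r IH// (addrA W); lra.
rewrite mul0r add0r zero; last by apply/allP => t /sl; move/le_lt_trans; exact.
rewrite big_seq_cond big1 ?addr0 ?subrr// => t /andP[/sl ts].
by rewrite leNgt (le_lt_trans ts ms).
Qed.

(** Once the order is fixed the extension is linear in [x], so it commutes both with the integral
    over levels and with the mean over [Y]. *)
Lemma xlog_lovasz_linear l W : uniq l -> exists d : S -> R,
  forall x, xlog_lovasz x l W = \sum_(s <- l) x s * d s.
Proof.
elim: l W => [|s l IH] W /=; first by exists (fun=> 0) => x; rewrite big_nil.
move=> /andP[sl ul]; have [d dE] := IH (W + w s) ul.
exists (fun t => if t == s then xlog (W + w s) - xlog W else d t) => x.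
rewrite big_cons eqxx dE; congr (_ + _); apply: eq_big_seq => t tl.
by case: eqP => // ts; move: sl; rewrite -ts tl.
Qed.

End Lovasz.

Section StepIntegral.
Variables (R : realType) (S : finType).

(** The indicator of [m <= a s] integrates to [a s] over the unit interval, so a linear functional
    of the level indicators integrates to its value at [a]. *)
Lemma integral_step (a d : S -> R) (g : R -> R) :
  (forall s, 0 <= a s) -> (forall s, a s <= 1) ->
  (forall m, 0 <= m -> m <= 1 -> g m = \sum_s (m <= a s)%R%:R * d s) ->
  (\int[lebesgue_measure]_(m in `[0%R, 1%R]) (g m)%:E = (\sum_s a s * d s)%:E)%E.
Proof.
move=> a0 a1 gE.
have mD : measurable (`[0%R, 1%R]%classic : set R) by exact: measurable_itv.
have int_ind s : (@lebesgue_measure R).-integrable `[0%R, 1%R]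
    (fun m => (\1_(`[0, a s]%classic) m)%:E).
  apply: (@integrableS _ _ _ _ setT) => //.
  exact: (@integrable_indic_itv R 0 (a s) true false).
under eq_integral => m.
  rewrite inE /= in_itv /= => /andP[m0 m1].
  rewrite gE// (_ : (\sum_s _)%:E =
     \sum_(s <- index_enum S | true) ((d s)%:E * (\1_(`[0, a s]%classic) m)%:E)%E); last first.
    rewrite -sumEFin; apply: eq_bigr => s _; rewrite -EFinM mulrC indicE.
    congr (_ * _%:R)%:E.
    by rewrite mem_setE in_itv /= m0.
  over.
rewrite integral_sum//; last by move=> s; exact: integrableZl.
rewrite -sumEFin; apply: eq_bigr => s _.
rewrite integralZl// integral_indic//.
rewrite setIidl; last first.
  move=> m /=; rewrite !in_itv /= => /andP[-> ma] /=; exact: (le_trans ma (a1 s)).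
have E : lebesgue_measure (`[0%R, a s]%classic : set R) = (a s)%:E.
  rewrite lebesgue_measure_itv /= lte_fin -EFinB subr0.
  by case: ltP => // as0; congr (_%:E); apply/eqP; rewrite eq_le a0 as0.
by rewrite [X in (_ * X)%E]E -EFinM mulrC.
Qed.

End StepIntegral.

Section LayeredBound.
Variables (R : realType) (Om : choiceType) (P : Om -> R).
Hypothesis hP : is_pmf P.
Variables (S : finType) (T C : choiceType).
Variables (f : Om -> S) (h : Om -> T) (Y : Om -> C).
Hypothesis fY : forall s y,
  dist P (fun w => (f w, Y w)) (s, y) = dist P f s * dist P Y y.

Let c t s := dist P (fun w => (f w, h w)) (s, t) / dist P f s.

(** Fix the order that sorts [c t]. The left side is the corresponding linear functional at [c t].
    At the posteriors [P(t|s,y)] the same functional is at most [xlog] of [P(t|y)], and these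
    posteriors average to [c t] over [y]. *)
Lemma integral_xlog_le_cent t :
  (\int[lebesgue_measure]_(m in `[0%R, 1%R])
     (xlog (\sum_(s | (m <= c t s)%R) dist P f s))%:E <=
   tot (fun y => dist P (fun w => (h w, Y w)) (t, y) *
     log2 (dist P Y y / dist P (fun w => (h w, Y w)) (t, y)))%R)%E.
Proof.
pose ds := dist P f; pose dt := dist P (fun w => (h w, Y w)).
pose dsty (s : S) y := dist P (fun w => (f w, (h w, Y w))) (s, (t, y)).
have ds0 s : 0 <= ds s by exact: dist_ge0.
have dt0 y : 0 <= dt y by exact: dist_ge0.
have dsty0 s y : 0 <= dsty s y by exact: dist_ge0.
have dY0 y : 0 <= dist P Y y by exact: dist_ge0.
have c0 s : 0 <= c t s by rewrite divr_ge0 ?dist_ge0.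
have c1 s : c t s <= 1.
  have := ds0 s; rewrite /c -/ds le_eqVlt => /orP[/eqP<-|s0].
    by rewrite invr0 mulr0.
  by rewrite ler_pdivrMr// mul1r dist_mono// => w [].
pose l := sort (fun s s' : S => c t s' <= c t s) (index_enum S).
have ls : perm_eq l (index_enum S) by rewrite perm_sort.
have sl : sorted (fun s s' : S => c t s' <= c t s) l.
  by apply: sort_sorted => s s'; exact: le_total.
have ul : uniq l by rewrite sort_uniq index_enum_uniq.
have [d dE] := xlog_lovasz_linear ds 0 ul.
have bigl (F : S -> R) (p : pred S) : \sum_(s <- l | p s) F s = \sum_(s | p s) F s.
  exact: perm_big.
rewrite (@integral_step _ _ (c t) d)//; last first.
  move=> m m0 m1; rewrite -(bigl _ xpredT) -dE xlog_lovasz_level// xlog0 subr0.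
  by rewrite add0r bigl.
have sum_dsty y : \sum_s dsty s y = dt (t, y).
  apply: EFin_inj; rewrite (dist_margin hP f) -tot_fin//.
(* The coefficients [d s] may be negative; the shift by [M] makes them summable by [tot] and is
   subtracted at the end. *)
pose M := \sum_s `|d s|.
have dM s : 0 <= d s + M.
  have : `|d s| <= M by rewrite /M (bigD1 s)//= lerDl sumr_ge0.
  by have := ler_norm (- d s); rewrite normrN; lra.
have M0 : 0 <= M by rewrite sumr_ge0.
have dsE s y : dsty s y / ds s * ds s = dsty s y.
  have := ds0 s; rewrite le_eqVlt => /orP[/eqP d0|d0]; last by rewrite divfK ?gt_eqF.
  rewrite -d0 mulr0; apply/eqP; rewrite eq_le dsty0 d0.
  by rewrite dist_mono// => w [].
have pw y : \sum_s (d s + M) * (dsty s y / ds s) <=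
    dt (t, y) * log2 (dist P Y y / dt (t, y)) + \sum_s M * (dsty s y / ds s).
  rewrite -lerBlDr -sumrB; under eq_bigr do rewrite mulrDl addrK.
  have := dY0 y; rewrite le_eqVlt => /orP[/eqP y0|y0].
    have dt00 : dt (t, y) = 0.
      by apply/eqP; rewrite eq_le dt0 y0 dist_mono// => w [].
    rewrite dt00 mul0r big1// => s _.
    suff -> : dsty s y = 0 by rewrite mul0r mulr0.
    by apply/eqP; rewrite eq_le dsty0 -dt00 dist_mono// => w [_ -> ->].
  (* Independence makes the denominator the joint law of [(s, y)], so [x s] is the posterior
     [P(t|s,y)] and is at most 1. *)
  pose x s := dsty s y / (ds s * dist P Y y).
  have x0 s : 0 <= x s by rewrite divr_ge0// mulr_ge0.
  have x1 s : x s <= 1.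
    have := ds0 s; rewrite /x le_eqVlt => /orP[/eqP<-|s0].
      by rewrite mul0r invr0 mulr0.
    rewrite ler_pdivrMr ?mulr_gt0// mul1r -fY.
    by rewrite dist_mono// => w [-> _ ->].
  have := xlog_lovasz_le l ds0 x0 x1 (lexx 0) (lexx 0).
  rewrite dE xlog0 subr0 add0r !bigl.
  have -> : \sum_s ds s * x s = dt (t, y) / dist P Y y.
    rewrite -sum_dsty mulr_suml; apply: eq_bigr => s _.
    by rewrite -[in RHS]dsE /x invfM; ring.
  rewrite -(ler_pM2l y0) => key.
  apply: (@le_trans _ _ (dist P Y y * \sum_s x s * d s)); last apply: (le_trans key).
    rewrite mulr_sumr ler_sum// => s _; rewrite /x invfM.
    rewrite le_eqVlt; apply/orP; left; apply/eqP.
    rewrite [RHS](_ : _ = d s * (dsty s y / ds s) * (dist P Y y / dist P Y y)).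
      by rewrite divff ?mulr1 ?gt_eqF.
    by ring.
  have -> : dist P Y y * xlog (dt (t, y) / dist P Y y) =
      - dt (t, y) * log2 (dt (t, y) / dist P Y y).
    by rewrite /xlog; field; rewrite gt_eqF.
  have := dt0 (t, y); rewrite le_eqVlt => /orP[/eqP<-|t0].
    by rewrite oppr0 !mul0r.
  by rewrite !log2_div//; lra.
have tdsty s : tot (fun y => dsty s y / ds s) = (c t s)%:E.
  under eq_tot do rewrite mulrC.
  rewrite totZ ?invr_ge0// /c mulrC EFinM; congr (_ * _)%E.
  rewrite (dist_margin hP Y); apply: eq_tot => y; apply/eqP.
  by rewrite eq_le !dist_mono// => w; [case=> -> [-> ->]|case=> -> -> ->].
have tsum (F : S -> R) : (forall s, 0 <= F s) ->
    tot (fun y => \sum_s F s * (dsty s y / ds s)) = (\sum_s F s * c t s)%:E.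
  move=> F0; rewrite /tot; under eq_esum do rewrite -sumEFin.
  rewrite esum_sum; last by move=> *; rewrite lee_fin mulr_ge0// divr_ge0.
  rewrite -sumEFin; apply: eq_bigr => s _.
  rewrite -/(tot (fun y => F s * (dsty s y / ds s))) totZ ?tdsty//.
  by move=> y; rewrite divr_ge0.
have := le_tot pw; rewrite tsum// totD; last 2 first.
- by move=> y; rewrite mulr_ge0//; apply: log2_ratio_ge0 => // w [].
- by move=> y; rewrite sumr_ge0// => s _; rewrite mulr_ge0// divr_ge0.
rewrite tsum// -leeBlDr// -EFinB -sumrB.
under eq_bigr do rewrite mulrDl addrK mulrC.
done.
Qed.

End LayeredBound.

Section UpperU0.
Variables (R : realType) (S : finType) (X T : countType).
Variable P : (S * X * T)%type -> R.
Hypothesis hP : is_pmf P.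
Hypothesis HT : (ent P (@vT S X T) < +oo)%E.

Lemma g0_le_U0 r : (g0 r P <= U0 P)%E.
Proof.
apply: ge_ereal_sup => _ [q [hq [mS [_ ->]]]].
have hJ : is_pmf (joint P q) := kernel_pmf hP hq.
have HS : (ent (joint P q) (@wS S X T) < +oo)%E by exact: ent_finType.
have fY s y := mi_eq0_indep hJ s y HS mS.
rewrite /mi /U0 (_ : ent (joint P q) _ = ent P (@vT S X T)); last first.
  exact: (ent_kernel_fst hP hq (@vT S X T)).
rewrite leeB//.
rewrite /cent -[leRHS]/(tot _) tot_pair; last first.
  move=> [t y]; rewrite mulr_ge0 ?dist_ge0//.
  by apply: log2_ratio_ge0 => // w [].
apply: le_esum => t _.
have := integral_xlog_le_cent hJ (@wT S X T) fY t.
congr (_ <= _)%E; apply: eq_integral => m _; congr (_%:E).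
have E1 : dist (joint P q) (@wS S X T) = dist P (@vS S X T).
  exact: (dist_kernel_fst hP hq).
have E2 : dist (joint P q) (fun w => (wS w, wT w)) =
    dist P (fun w => (@vS S X T w, vT w)).
  exact: (dist_kernel_fst hP hq (fun w => (vS w, vT w))).
by rewrite E1 E2.
Qed.

End UpperU0.

(** * The race of geometric clocks *)

Section PowerBounds.
Variables (R : realType) (q : R).
Hypotheses (q0 : 0 < q) (q1 : q < 1).

Let qn_ge0 n : 0 <= q ^+ n. Proof. exact/exprn_ge0/ltW. Qed.
Let qn_le1 n : q ^+ n <= 1. Proof. by apply: exprn_ile1; exact: ltW. Qed.

(** [1 - q ^+ n] is [1 - q] times a sum of [n] powers, each between [q ^+ n] and 1; this lemma and
    the next are the two resulting bounds. *)
Lemma subr1_expr_le n : 1 - q ^+ n <= n%:R * (1 - q).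
Proof.
elim: n => [|n IH]; first by rewrite expr0 subrr mul0r.
rewrite exprS -natr1 mulrDl mul1r.
have : 0 <= (1 - q) * (1 - q ^+ n) by rewrite mulr_ge0 ?subr_ge0 ?qn_le1// ltW.
lra.
Qed.

Lemma subr1_expr_ge n : n%:R * q ^+ n * (1 - q) <= 1 - q ^+ n.
Proof.
elim: n => [|n IH]; first by rewrite expr0 subrr !mul0r.
have h : n%:R * q ^+ n * (1 - q) * q <= 1 - q ^+ n.
  apply: le_trans IH; rewrite ler_piMr ?(ltW q1)// mulr_ge0 ?mulr_ge0// subr_ge0.
  exact: ltW.
have : q * q ^+ n <= q ^+ n by rewrite ler_piMl// ltW.
have : 0 <= (1 - q) * (q ^+ n - q * q ^+ n).
  by rewrite mulr_ge0// subr_ge0 ?(ltW q1)// ler_piMl// ltW.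
by rewrite exprS -natr1; lra.
Qed.

(* The chord bound for the convex sequence [m |-> q ^+ m] on [[0, m + l]]. *)
Lemma expr_chord m l :
  (m + l)%:R * (q ^+ m * (1 - q ^+ l)) <= l%:R * (1 - q ^+ (m + l)).
Proof.
have A := subr1_expr_ge m; have B := subr1_expr_le l.
have C : m%:R * q ^+ m * (1 - q ^+ l) <= l%:R * (1 - q ^+ m).
  apply: (@le_trans _ _ (m%:R * q ^+ m * (l%:R * (1 - q)))).
    by rewrite ler_wpM2l// mulr_ge0.
  by have := ler_wpM2l (ler0n _ l) A; lra.
by move: C; rewrite natrD exprD; lra.
Qed.

Lemma sum_expr_lt1 N (x : R) : (1 - x) * \sum_(k < N) x ^+ k = 1 - x ^+ N.
Proof.
rewrite -[X in X - x ^+ N](expr1n _ N) subrXX; congr (_ * _).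
by apply: eq_bigr => i _; rewrite expr1n mul1r.
Qed.

(** Partial sums of the power series of the inverse square of [1 - x]; they bound the mean number of
    rounds. *)
Lemma sum_succ_expr_le N (x : R) : 0 <= x -> x <= 1 ->
  (1 - x) ^+ 2 * \sum_(k < N) k.+1%:R * x ^+ k <= 1.
Proof.
move=> x0 x1.
have -> : (1 - x) ^+ 2 * \sum_(k < N) k.+1%:R * x ^+ k =
    1 - N.+1%:R * x ^+ N + N%:R * x ^+ N.+1.
  elim: N => [|N IH]; first by rewrite big_ord0 expr0; ring.
  by rewrite big_ord_recr /= mulrDr IH !exprS -!natr1; ring.
rewrite exprS -natr1.
have xN : 0 <= x ^+ N by rewrite exprn_ge0.
have : x * x ^+ N <= x ^+ N by rewrite ler_piMl.
move=> h; have := ler_wpM2l (ler0n R N) h; lra.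
Qed.

End PowerBounds.

Section Race.
Variables (R : realType) (q : R) (C : finType) (J : nat).
Hypotheses (q0 : 0 < q) (q1 : q < 1).

(* A geometric clock truncated at [J]: the value [J] means that it never rings. *)
Definition geo (j : 'I_J.+1) : R := if (j < J)%N then (1 - q) * q ^+ j else q ^+ J.

Definition clocks (w : {ffun C -> 'I_J.+1}) : R := \prod_c geo (w c).

Lemma geo_ge0 j : 0 <= geo j.
Proof.
rewrite /geo; case: ifP => _; last exact/exprn_ge0/ltW.
by rewrite mulr_ge0 ?subr_ge0 ?exprn_ge0 ?ltW.
Qed.

Lemma clocks_ge0 w : 0 <= clocks w.
Proof. by apply: prodr_ge0 => c _; exact: geo_ge0. Qed.

Lemma sum_geo (F : nat -> R) :
  \sum_(j : 'I_J.+1) geo j * F j =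
  \sum_(j < J) (1 - q) * q ^+ j * F j + q ^+ J * F J.
Proof.
rewrite big_ord_recr /= /geo ltnn; congr (_ + _).
by apply: eq_bigr => j _ /=; rewrite ltn_ord.
Qed.

(** The atom at [J] collects the whole remaining tail, so tails up to the horizon stay exactly
    geometric and the race has closed-form probabilities. *)
Lemma geo_tail m : (m <= J)%N -> \sum_j geo j * (m <= j)%N%:R = q ^+ m.
Proof.
move=> mJ; rewrite (sum_geo (fun j => (m <= j)%N%:R)) mJ mulr1.
rewrite -(big_mkord xpredT (fun j => (1 - q) * q ^+ j * (m <= j)%N%:R)).
rewrite (big_cat_nat (leq0n m) mJ)/=.
rewrite [X in X + _ + _]big_nat_cond big1 ?add0r; last first.
  by move=> j; rewrite andbT => /andP[_ jm]; rewrite leqNgt jm mulr0.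
rewrite (eq_big_nat _ _ (F2 := fun j => q ^+ j - q ^+ j.+1)); last first.
  by move=> j /andP[-> _]; rewrite mulr1 exprS; ring.
rewrite -(opprK (\sum_(_ <= _ < _) _)) -sumrN.
under eq_bigr do rewrite opprB.
by rewrite telescope_sumr// opprB subrK.
Qed.

Lemma sum_clocks (g : C -> 'I_J.+1 -> R) :
  \sum_w clocks w * \prod_c g c (w c) = \prod_c \sum_j geo j * g c j.
Proof.
rewrite bigA_distr_bigA; apply: eq_bigr => w _.
by rewrite /clocks -big_split.
Qed.

Lemma sum_geo1 : \sum_j geo j = 1.
Proof. by rewrite -[RHS](geo_tail (leq0n J)); apply: eq_bigr => j _; rewrite mulr1. Qed.

Lemma sum_clocks1 : \sum_w clocks w = 1.
Proof.
rewrite /clocks -(bigA_distr_bigA (fun _ : C => geo)) big1// => c _.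
exact: sum_geo1.
Qed.

Lemma sum_clocks_coord c (F : 'I_J.+1 -> R) :
  \sum_w clocks w * F (w c) = \sum_j geo j * F j.
Proof.
pose g c' j := if c' == c then F j else 1.
have E (w : {ffun C -> 'I_J.+1}) : F (w c) = \prod_c' g c' (w c').
  by rewrite -big_mkcond big_pred1_eq.
transitivity (\sum_w clocks w * \prod_c' g c' (w c')).
  by apply: eq_bigr => w _; rewrite E.
rewrite sum_clocks (bigD1 c)//= /g eqxx.
rewrite [X in _ * X]big1 ?mulr1// => c' /negPf ->.
rewrite -[RHS]sum_geo1; by apply: eq_bigr => j _; rewrite mulr1.
Qed.

Variables (n : C -> nat) (N : nat).
Let G := (\sum_c n c)%N.
Hypothesis NGJ : (N * G <= J)%N.

(* In round [k], competitor [c] inspects ticks [k * n c] to [k.+1 * n c - 1] of its clock. The first round with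
   a ringing clock decides the race, and a tie leaves it without a winner. *)
Definition wins_at c k (w : {ffun C -> 'I_J.+1}) : bool :=
  [&& k * n c <= w c, w c < k.+1 * n c &
      [forall (c' | c' != c), k.+1 * n c' <= w c']]%N.

Definition wins c w : bool := [exists k : 'I_N, wins_at c k w].

Lemma wins_at_inj c k k' w : wins_at c k w -> wins_at c k' w -> k = k'.
Proof.
wlog kk' : k k' / (k <= k')%N.
  by move=> W h h'; case/orP: (leq_total k k') => /W; [|move=> <-//]; apply.
move=> /and3P[_ u _] /and3P[l _ _]; apply/eqP; rewrite eqn_leq kk' leqNgt.
apply/negP => lt; move: u; rewrite ltnNge => /negP; apply.
by apply: leq_trans l; rewrite leq_mul2r lt orbT.
Qed.

(** A winner of round [k] leaves every other clock silent through round [k], so any other winner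
    would need a strictly later round, and symmetrically. *)
Lemma wins_inj c c' w : wins c w -> wins c' w -> c = c'.
Proof.
move=> /existsP[k /and3P[l u a]] /existsP[k' /and3P[l' u' a']].
apply/eqP/negPn/negP => cc'.
have {a} := forall_inP a c'; rewrite eq_sym cc' => /(_ isT) a.
have {a'} := forall_inP a' c; rewrite cc' => /(_ isT) a'.
have kk' : (k < k')%N.
  by move: (leq_ltn_trans a u'); rewrite ltn_mul2r ltnS => /andP[].
have k'k : (k' < k)%N.
  by move: (leq_ltn_trans a' u); rewrite ltn_mul2r ltnS => /andP[].
by move: (ltn_trans kk' k'k); rewrite ltnn.
Qed.

Lemma winsE c w : (wins c w)%:R = \sum_(k < N) (wins_at c k w)%:R :> R.
Proof.
rewrite /wins; case: existsP => [[k wk]|nw]; last first.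
  by rewrite big1// => k _; case wk : (wins_at c k w) => //; case: nw; exists k.
rewrite (bigD1 k)//= wk big1 ?addr0// => k' /eqP kk'.
by case E : (wins_at c k' w) => //; case: kk'; apply/val_inj/(wins_at_inj E wk).
Qed.

(** The clocks are independent: [c] rings within its window of round [k], a difference of two tails,
    and each rival stays silent through that round, one tail. *)
Lemma prob_wins_at c k : (k < N)%N ->
  \sum_w clocks w * (wins_at c k w)%:R =
  q ^+ G ^+ k * (q ^+ (G - n c) * (1 - q ^+ n c)).
Proof.
move=> kN.
have nG c' : (n c' <= G)%N by rewrite /G (bigD1 c')//= leq_addr.
have knJ c' k' : (k' <= N)%N -> (k' * n c' <= J)%N.
  by move=> k'N; apply: leq_trans NGJ; apply: leq_mul.
pose g c' (j : 'I_J.+1) : R := if c' == c then (k * n c <= j < k.+1 * n c)%N%:R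
                        else (k.+1 * n c' <= j)%N%:R.
have E w : (wins_at c k w)%:R = \prod_c' g c' (w c').
  rewrite (bigD1 c)//= /g eqxx /wins_at andbA.
  case: (k * n c <= w c < k.+1 * n c)%N => /=; last by rewrite mul0r.
  rewrite mul1r; case: forallP => [a|a].
    by rewrite big1// => c' cc'; rewrite (negPf cc'); have := a c'; rewrite cc' /= => ->.
  case: (pickP (fun c' => ~~ ((c' != c) ==> (k.+1 * n c' <= w c')%N))) => [c'|a'].
    rewrite negb_imply => /andP[cc' lt].
    by rewrite (bigD1 c')//= (negPf cc') (negPf lt) mul0r.
  by case: a => c'; have /negPn := negbT (a' c').
under eq_bigr do rewrite E; rewrite sum_clocks (bigD1 c)//= /g eqxx.
have -> : \sum_j geo j * (k * n c <= j < k.+1 * n c)%N%:R =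
    q ^+ (k * n c) - q ^+ (k.+1 * n c).
  rewrite -(geo_tail (knJ c k (ltnW kN))) -(geo_tail (knJ c k.+1 kN)) -sumrB.
  apply: eq_bigr => j _; rewrite -mulrBr; congr (_ * _).
  have lemul : (k * n c <= k.+1 * n c)%N by rewrite leq_mul2r leqnSn orbT.
  rewrite [(j < _)%N]ltnNge; case: (leqP (k.+1 * n c) j) => [h|h] /=.
    by rewrite (leq_trans lemul h) subrr.
  by rewrite andbT subr0.
rewrite (eq_bigr (fun c' => q ^+ (k.+1 * n c'))); last first.
  by move=> c' /negPf ->; rewrite geo_tail// knJ.
rewrite -expr_sum -big_distrr /=.
have -> : (\sum_(c' | c' != c) n c' = G - n c)%N.
  by rewrite /G [in RHS](bigD1 c)//= addKn.
have -> : (k.+1 * n c = k * n c + n c)%N by rewrite mulSn addnC.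
rewrite exprD -exprM -[X in q ^+ (X * k)](subnK (nG c)) mulnDl exprD.
rewrite mulSn exprD ![(_ * k)%N]mulnC; ring.
Qed.

Lemma prob_wins c :
  (1 - q ^+ G) * \sum_w clocks w * (wins c w)%:R =
  (1 - q ^+ G ^+ N) * (q ^+ (G - n c) * (1 - q ^+ n c)).
Proof.
under eq_bigr do rewrite winsE mulr_sumr.
rewrite exchange_big /=.
under eq_bigr => k _ do rewrite prob_wins_at//.
by rewrite -mulr_suml (mulrA (1 - _)) sum_expr_lt1.
Qed.

Hypothesis G0 : (0 < G)%N.
Let qG1 : q ^+ G < 1.
Proof. by rewrite exprn_ilt1 ?ltW// -lt0n. Qed.
Let qG0 : 0 < q ^+ G. Proof. exact: exprn_gt0. Qed.

Let nG c : (n c <= G)%N. Proof. by rewrite /G (bigD1 c)//= leq_addr. Qed.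

Let weight_le c : q ^+ (G - n c) * (1 - q ^+ n c) <= (n c)%:R / G%:R * (1 - q ^+ G).
Proof.
have := expr_chord q0 q1 (G - n c) (n c).
by rewrite subnK// => h; rewrite mulrAC ler_pdivlMr ?ltr0n//; lra.
Qed.

(** Discretisation only loses probability. Having no error term here is what makes the selected
    pairs a sub-law of [p], with a nonnegative residual. *)
Lemma prob_wins_le c : \sum_w clocks w * (wins c w)%:R <= (n c)%:R / G%:R.
Proof.
rewrite -(ler_pM2l (_ : 0 < 1 - q ^+ G)) ?subr_gt0// prob_wins mulrC.
rewrite [leRHS]mulrC; apply: le_trans (weight_le c); rewrite ler_piMr//.
  by rewrite mulr_ge0 ?exprn_ge0 ?subr_ge0 ?exprn_ile1// ltW.
by rewrite lerBlDr lerDl exprn_ge0// ltW.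
Qed.

(** The factor [q ^+ G] pays for ties, and the last factor for races undecided after [N] rounds. *)
Lemma prob_wins_ge c :
  (n c)%:R / G%:R * q ^+ G * (1 - q ^+ G ^+ N) <=
  \sum_w clocks w * (wins c w)%:R.
Proof.
rewrite -(ler_pM2l (_ : 0 < 1 - q ^+ G)) ?subr_gt0// prob_wins.
rewrite mulrA mulrC ler_wpM2l//.
  by rewrite subr_ge0 exprn_ile1// ltW.
apply: (@le_trans _ _ (G%:R * (1 - q) * ((n c)%:R / G%:R * q ^+ G))).
  rewrite ler_wpM2r ?subr1_expr_le// mulr_ge0 ?(ltW qG0)// divr_ge0//.
have -> : G%:R * (1 - q) * ((n c)%:R / G%:R * q ^+ G) =
    q ^+ (G - n c) * ((n c)%:R * q ^+ (n c) * (1 - q)).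
  have -> : q ^+ G = q ^+ (G - n c) * q ^+ n c by rewrite -exprD subnK.
  by field; rewrite pnatr_eq0 -lt0n.
by rewrite ler_wpM2l ?subr1_expr_ge// exprn_ge0// ltW.
Qed.

(** A win in round [k] keeps the ringing tick, counted from one, below [k.+1 * n c]; the deciding
    round is geometric with ratio [q ^+ G], which produces [1 - q ^+ G] in the denominator. *)
Lemma mean_wins_le c :
  \sum_w clocks w * (wins c w)%:R * (w c).+1%:R <=
  (n c)%:R / (1 - q ^+ G) * ((n c)%:R / G%:R).
Proof.
have d0 : 0 < 1 - q ^+ G by rewrite subr_gt0.
have W0 : 0 <= q ^+ (G - n c) * (1 - q ^+ n c).
  by rewrite mulr_ge0 ?exprn_ge0 ?subr_ge0 ?exprn_ile1// ltW.
apply: (@le_trans _ _ (\sum_(k < N) (k.+1%:R * q ^+ G ^+ k) *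
    ((n c)%:R * (q ^+ (G - n c) * (1 - q ^+ n c))))).
  under eq_bigr do rewrite winsE mulr_sumr mulr_suml.
  rewrite exchange_big /= ler_sum// => k _.
  apply: (@le_trans _ _ (\sum_w clocks w * (wins_at c k w)%:R * (k.+1%:R * (n c)%:R))).
    apply: ler_sum => w _; case E : (wins_at c k w); last by rewrite mulr0 !mul0r.
    rewrite mulr1 ler_wpM2l ?clocks_ge0// -natrM ler_nat.
    by case/and3P: E.
  by rewrite -mulr_suml prob_wins_at//; lra.
rewrite -mulr_suml.
rewrite -(ler_pM2l (_ : 0 < (1 - q ^+ G) ^+ 2)) ?exprn_gt0// [leLHS]mulrA.
apply: (@le_trans _ _ (1 * ((n c)%:R * (q ^+ (G - n c) * (1 - q ^+ n c))))).
  by rewrite ler_wpM2r ?(mulr_ge0 (ler0n _ _) W0)// sum_succ_expr_le// ltW.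
have -> : (1 - q ^+ G) ^+ 2 * ((n c)%:R / (1 - q ^+ G) * ((n c)%:R / G%:R)) =
   (n c)%:R * ((n c)%:R / G%:R * (1 - q ^+ G)).
  by field; rewrite pnatr_eq0 -lt0n G0 gt_eqF.
by rewrite mul1r ler_wpM2l.
Qed.

End Race.

Section TotMore.
Variable R : realType.
Implicit Types I J : choiceType.

Lemma tot_comp_le I J (e : I -> J) (F : J -> R) : injective e ->
  (forall j, 0 <= F j) -> (tot (fun i => F (e i)) <= tot F)%E.
Proof.
move=> ei F0; rewrite /tot.
rewrite -(esum_image setT e (fun j => (F j)%:E)); last by move=> ? ? _ _ /ei.
rewrite esum_mkcond; apply: le_esum => j _.
by case: ifP => // _; rewrite lee_fin.
Qed.

Lemma tot_tail I (F : I -> R) (eps : R) : 0 < eps -> (forall i, 0 <= F i) ->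
  (tot F < +oo)%E ->
  exists l : seq I, (tot (fun i => (i \notin l)%:R * F i)%R <= eps%:E)%E.
Proof.
move=> e0 F0 Foo.
have Ff : tot F \is a fin_num by rewrite ge0_fin_numE ?tot_ge0.
have [_ [A [finA _] <-] lt] := ub_ereal_sup_adherent e0 Ff.
exists (finmap.enum_fset (fset_set A)); move: lt.
have E : tot F = (\sum_(i \in A) (F i)%:E + tot (fun i => (i \notin finmap.enum_fset (fset_set A))%:R * F i)%R)%E.
  rewrite /tot (esumID A); last by move=> i _; rewrite lee_fin.
  rewrite !setTI; congr (_ + _)%E.
    by rewrite -esum_fset ?set_mem_set// => i _; rewrite lee_fin.
  rewrite tot_esum; apply: eq_tot => i; congr (_%:R * _).
  by rewrite in_setC; congr (~~ _); rewrite -[LHS](in_fset_set finA).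
have S0 : (0 <= \sum_(i \in A) (F i)%:E)%E.
  by rewrite fsume_ge0// => i _; rewrite lee_fin.
have T0 : (0 <= tot (fun i => (i \notin finmap.enum_fset (fset_set A))%:R * F i)%R)%E.
  by apply: tot_ge0 => i; rewrite mulr_ge0.
rewrite -[ereal_sup _]/(tot F); move: S0 T0 Ff; rewrite E.
case: (\sum_(i \in A) _)%E => [x||]//; case: (tot _) => [y||]//= _ _ _.
by rewrite -EFinB lte_fin lee_fin; lra.
Qed.

End TotMore.

(** * From the race to a coupling of a countable pair *)

Section RaceCoupling.
Variables (R : realType) (A B : countType) (p : A * B -> R).
Hypothesis hp : is_pmf p.
Variables (u : A * B -> R) (eps : R).
Hypotheses (u0 : forall ab, 0 <= u ab) (eps0 : 0 < eps).
Hypothesis pu : (tot (fun ab => p ab * u ab)%R < +oo)%E.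

Let PA := dist p fst.
Let PB := dist p snd.
Let p0 ab : 0 <= p ab. Proof. by case: hp. Qed.
Let PA0 a : 0 <= PA a. Proof. exact: dist_ge0. Qed.
Let PB0 a : 0 <= PB a. Proof. exact: dist_ge0. Qed.

Lemma dist_self ab : dist p (fun w => (w.1, w.2)) ab = p ab.
Proof.
apply: EFin_inj; rewrite distE// (@tot_seq _ _ [:: ab])//.
- by rewrite big_seq1 -surjective_pairing eqxx mul1r.
- by move=> w; rewrite mulr_ge0.
- by move=> w; rewrite inE -surjective_pairing => /negPf ->; rewrite mul0r.
Qed.

Lemma pmf_le_fst a b : p (a, b) <= PA a.
Proof. by rewrite -dist_self dist_mono// => w []. Qed.

Lemma pmf_le_snd a b : p (a, b) <= PB b.
Proof. by rewrite -dist_self dist_mono// => w []. Qed.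

Lemma tot_pmf_snd a : tot (fun b => p (a, b)) = (PA a)%:E.
Proof.
rewrite /PA (dist_margin hp snd); apply: eq_tot => b.
by rewrite dist_swap// dist_self.
Qed.

Lemma race_coupling :
  exists (Om : finType) (mu : Om -> R) (D : A -> B -> Om -> bool)
         (tau : B -> Om -> R) (V : B -> Om -> bool),
  [/\ (forall w, 0 <= mu w) /\ \sum_w mu w = 1,
      (forall a b b' w, D a b w -> D a b' w -> b = b') /\
      (forall a b w, D a b w -> V b w) /\ (forall b w, 0 <= tau b w),
      (forall a b, PA a * (\sum_w mu w * (D a b w)%:R) <= p (a, b)) /\
      (tot (fun ab => (p ab - PA ab.1 * (\sum_w mu w * (D ab.1 ab.2 w)%:R)) * u ab)%R
        <= eps%:E)%E,
      (forall a b, 0 < p (a, b) ->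
        PA a * (\sum_w mu w * (D a b w)%:R * tau b w) <=
        (1 + eps) * p (a, b) * (p (a, b) / (PA a * PB b))) &
      (forall b (phi Phi : R -> R), 0 < PB b ->
        (forall x, 0 <= phi x) -> (forall x, 0 <= x -> 0 <= Phi x) ->
        (forall x h, 0 <= x -> 0 < h -> h * phi (x + h) <= Phi x - Phi (x + h)) ->
        \sum_w mu w * ((V b w)%:R * phi (tau b w)) <= PB b * Phi 0)].
Proof.
have tpu0 : (0 <= tot (fun ab => p ab * u ab)%R)%E.
  by apply: tot_ge0 => ab; rewrite mulr_ge0.
have [U U0 tU] : exists2 U, 0 <= U & tot (fun ab => p ab * u ab) = U%:E.
  by move: pu tpu0; case: (tot _) => // U _ U0; exists U.
have U1 : 0 < U + 1 by rewrite ltr_wpDl.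
have eps1 : 0 < 1 + eps by rewrite addr_gt0.
(* Two demands are met at once: [3 * e' * U] is at most [eps / 2], and [(1 + eps) * (1 - e')] is at
   least 1. *)
have [e' e'0 e'E] : exists2 e', 0 < e' & e' * (6 * (U + 1) * (1 + eps)) = eps.
  exists (eps / (6 * (U + 1) * (1 + eps))); first by rewrite divr_gt0// !mulr_gt0.
  by rewrite divfK// gt_eqF// !mulr_gt0.
have ee0 := mulr_gt0 e'0 eps1; have eeU := mulr_ge0 (ltW ee0) U0.
have eU := mulr_ge0 (ltW e'0) U0; have eeps := mulr_gt0 e'0 eps0.
have e'U : 6 * (e' * U) <= eps.
  by have := mulr_ge0 (mulr_ge0 (ltW e'0) (ltW eps0)) U0; lra.
have e'2 : e' * (1 + eps) <= eps by lra.
have e'1 : e' < 1.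
  by rewrite ltNge; apply/negP => /(ler_wpM2r (ltW eps1)); move: e'2; lra.
(* Only outcomes occurring in [l] receive a clock; the pairs outside carry [u]-weighted mass at most
   [eps / 2] and are given up. *)
have [l lP] := tot_tail (divr_gt0 eps0 (ltr0n R 2)) (fun ab => mulr_ge0 (p0 ab) (u0 ab)) pu.
pose r := undup [seq ab.2 | ab <- l].
(* The sum of the inverses dominates each of them, so rounding a rate to a multiple of [1 / G] costs
   a fraction at most [e'] of every non-null pair in [l]. *)
pose G := (Num.trunc (\sum_(ab <- l) (e' * p ab)^-1)).+1.
have GP ab : ab \in l -> G%:R^-1 <= e' * p ab \/ p ab = 0.
  move=> abl; have := p0 ab; rewrite le_eqVlt => /orP[/eqP<-|pp]; first by right.
  left; have h0 : 0 < e' * p ab by rewrite mulr_gt0.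
  rewrite invf_ple ?posrE ?ltr0n//; apply: ltW.
  apply: le_lt_trans (truncnS_gt _).
  rewrite (big_rem _ abl) /= lerDl sumr_ge0// => i _.
  by rewrite invr_ge0 mulr_ge0// ltW.
have G0 : (0 < G)%N by [].
have GR : 0 < G%:R :> R by rewrite ltr0n.
(* With this [q] a round contains a ring with probability at most [e'], so ties are rare. *)
pose q := 1 - e' / G%:R.
have eG : 0 < e' / G%:R by rewrite divr_gt0.
have eG1 : e' / G%:R < 1.
  by rewrite ltr_pdivrMr// mul1r (lt_le_trans e'1)// ler1n.
have q0 : 0 < q by rewrite /q subr_gt0.
have q1 : q < 1 by rewrite /q ltrBlDr ltrDl.
have qG : 1 - e' <= q ^+ G.
  have Gq : G%:R * (1 - q) = e' by rewrite /q; field; rewrite gt_eqF.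
  by have := subr1_expr_le q0 q1 G; rewrite Gq; lra.
have qG1 : q ^+ G < 1 by rewrite exprn_ilt1 ?ltW.
have qG0 : 0 < q ^+ G by rewrite exprn_gt0.
(* Enough rounds for the race to remain silent with probability at most [e']. *)
pose N := (Num.trunc (e' * (1 - q ^+ G))^-1).+1.
have qGN : q ^+ G ^+ N <= e'.
  have h0 : 0 < e' * (1 - q ^+ G) by rewrite mulr_gt0 ?subr_gt0.
  have h1 : 1 <= N%:R * (e' * (1 - q ^+ G)).
    by rewrite -ler_pdivrMr// mul1r; exact/ltW/truncnS_gt.
  have h2 : N%:R * q ^+ G ^+ N * (1 - q ^+ G) <= 1.
    apply: le_trans (subr1_expr_ge qG0 qG1 N) _.
    by rewrite lerBlDr lerDl exprn_ge0// ltW.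
  have NR : 0 < N%:R * (1 - q ^+ G) by rewrite mulr_gt0 ?ltr0n ?subr_gt0.
  by rewrite -(ler_pM2l NR); lra.
(* The dummy competitor [None] takes up the rounding loss, so that every race has total rate [G]
   and [b] wins with probability at most [n b / G <= P(b | a)]. *)
pose C : finType := option (seq_sub r).
pose rho a b := p (a, b) / PA a.
have rho0 a b : 0 <= rho a b by rewrite divr_ge0.
pose m a b := Num.trunc (G%:R * rho a b).
have mle a b : (m a b)%:R <= G%:R * rho a b by rewrite truncn_le mulr_ge0.
have mge a b : G%:R * rho a b < (m a b)%:R + 1 by rewrite natr1 truncnS_gt.
pose n a (c : C) := if c is Some b then m a (ssval b)
                    else (G - \sum_(b : seq_sub r) m a (ssval b))%N.
have PArho a b : PA a * rho a b = p (a, b).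
  have := PA0 a; rewrite /rho le_eqVlt => /orP[/eqP a0|a0].
    rewrite -a0 mul0r; apply/eqP; rewrite eq_le p0 /= [leRHS]a0.
    exact: pmf_le_fst.
  by rewrite mulrC divfK// gt_eqF.
have mG a : (\sum_(b : seq_sub r) m a (ssval b) <= G)%N.
  rewrite -(ler_nat R) natr_sum.
  apply: (@le_trans _ _ (\sum_(b : seq_sub r) G%:R * rho a (ssval b))).
    by apply: ler_sum => b _.
  rewrite -mulr_sumr ler_piMr//.
  rewrite -lee_fin -(@tot_fin _ (seq_sub r) (fun b => rho a (ssval b)))//.
  have ssval_inj : injective (@ssval _ r) by exact: val_inj.
  apply: le_trans (tot_comp_le ssval_inj (rho0 a)) _.
  rewrite /rho; under eq_tot do rewrite mulrC.
  rewrite totZ ?invr_ge0// tot_pmf_snd -EFinM lee_fin.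
  have := PA0 a; rewrite le_eqVlt => /orP[/eqP<-|a0]; first by rewrite mulr0.
  by rewrite mulVf// gt_eqF.
have nG a : (\sum_c n a c = G)%N.
  rewrite (bigD1 None)//= (reindex_omap Some id) /=; last by case.
  under [X in (_ + X)%N]eq_bigl do rewrite eqxx.
  by rewrite subnK.
pose J := (N * G)%N.
have NJ a : (N * (\sum_c n a c) <= J)%N by rewrite nG.
have sG a : (0 < \sum_c n a c)%N by rewrite nG.
pose Om : finType := {ffun C -> 'I_J.+1}.
pose D a b (w : Om) := if insub b is Some b' then wins (n a) N (Some b') w else false.
pose V b (w : Om) := if insub b is Some b' then (w (Some (b' : seq_sub r)) < J)%N else false.
(* A geometric clock with ticks of length [1 - q] imitates a unit exponential, here divided by
   [P(b)]. The [.+1] places [tau] at the right end of its tick, as the Riemann comparison needs. *)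
pose tau b (w : Om) := if insub b is Some b' then
   (w (Some (b' : seq_sub r))).+1%:R * ((1 - q) / PB b) else 0.
exists Om, (@clocks _ q C J), D, tau, V; split.
- split; first exact: clocks_ge0.
  exact: (@sum_clocks1 _ q C J).
- split; [|split].
  + move=> a b b' w; rewrite /D.
    case: insubP => // c _ cb; case: insubP => // c' _ cb' h h'.
    by have [] := wins_inj h h' => cc; rewrite -cb -cb' cc.
  + move=> a b w; rewrite /D /V; case: insubP => // c _ _ /existsP[k /and3P[_ h _]].
    apply: (leq_trans h); apply: leq_trans (NJ a); apply: leq_mul => //.
    by rewrite (bigD1 (Some c))//= leq_addr.
  + move=> b w; rewrite /tau; case: insubP => // c _ _.
    by rewrite mulr_ge0// divr_ge0// subr_ge0 ltW.
- have lower a b : 0 <= PA a * \sum_w clocks q w * (D a b w)%:R.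
    by rewrite mulr_ge0 ?sumr_ge0// => w _; rewrite mulr_ge0 ?clocks_ge0.
  have upper a b : PA a * (\sum_w clocks q w * (D a b w)%:R) <= p (a, b).
    rewrite /D; case: insubP => [c _ cb|_]; last first.
      by rewrite big1 ?mulr0// => w _; rewrite mulr0.
    have := prob_wins_le q0 q1 (NJ a) (sG a) (Some c); rewrite nG /= cb => h.
    rewrite -PArho ler_wpM2l// (le_trans h)// ler_pdivrMr// mulrC.
    exact: mle.
  split => //.
  have F0 ab : 0 <= p ab * u ab by rewrite mulr_ge0.
  (* On [l], rounding, ties and exhausted rounds each lose a fraction at most [e'], hence the 3; off
     [l] the whole mass is conceded. *)
  have key ab : (p ab - PA ab.1 * (\sum_w clocks q w * (D ab.1 ab.2 w)%:R)) * u ab <=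
      3 * e' * (p ab * u ab) + (ab \notin l)%:R * (p ab * u ab).
    case: ab => a b /=; have := upper a b; have := lower a b.
    set s := PA a * _ => s0 sp.
    have [abl|_] := boolP ((a, b) \in l); last first.
      rewrite mul1r; apply: (@le_trans _ _ (p (a, b) * u (a, b))).
        by rewrite ler_wpM2r//; lra.
      by rewrite lerDr mulr_ge0// mulr_ge0// ltW.
    rewrite mul0r addr0 mulrA ler_wpM2r//.
    case: (GP _ abl) => [Gp|pz]; last first.
      by rewrite pz mulr0; move: sp s0; rewrite pz; lra.
    have br : b \in r by rewrite mem_undup; apply/mapP; exists (a, b).
    have sE : s = PA a * \sum_w clocks q w *
        (wins (n a) N (Some (Sub b br : seq_sub r)) (w : Om))%:R.
      by rewrite /s /D (insubT (mem r) br).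
    move: s sE s0 sp => s sE s0 sp.
    have := prob_wins_ge q0 q1 (NJ a) (sG a) (Some (Sub b br : seq_sub r)).
    rewrite nG /= => h.
    have hs := ler_wpM2l (PA0 a) h; rewrite -sE in hs.
    have e2 : (1 - e') * (1 - e') <= q ^+ G * (1 - q ^+ G ^+ N).
      by apply: ler_pM => //; rewrite ?subr_ge0 ?(ltW e'1)//; lra.
    have x0 : 0 <= PA a * ((m a b)%:R / G%:R).
      by rewrite mulr_ge0// divr_ge0.
    have hs2 := le_trans (ler_wpM2l x0 e2) _; have {hs2}hs2 := hs2 s.
    have hs3 : PA a * ((m a b)%:R / G%:R) * ((1 - e') * (1 - e')) <= s.
      by apply: hs2; apply: le_trans hs; rewrite -!mulrA.
    have mg : p (a, b) - G%:R^-1 <= PA a * ((m a b)%:R / G%:R).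
      have g1 : rho a b - G%:R^-1 <= (m a b)%:R / G%:R.
        rewrite ler_pdivlMr// mulrBl mulVf ?gt_eqF// lerBlDr mulrC.
        exact/ltW/mge.
      have := ler_wpM2l (PA0 a) g1; rewrite mulrBr PArho.
      have PA1 : PA a <= 1 by exact: dist_le1.
      have Gi : 0 <= G%:R^-1 :> R by rewrite invr_ge0.
      have : PA a * G%:R^-1 <= G%:R^-1 by rewrite ler_piMl.
      lra.
    have e20 : 0 <= (1 - e') * (1 - e') by rewrite mulr_ge0 ?subr_ge0 ?ltW.
    have := ler_wpM2r e20 mg.
    have Gi : 0 <= G%:R^-1 :> R by rewrite invr_ge0.
    move: hs3 Gp Gi; have := p0 (a, b); move: (p (a, b)) => P0 P00.
    move: (PA a * _) => X; move: (G%:R^-1) => g hs3 gp g0 hX.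
    have h1 : 0 <= (1 - (1 - e') * (1 - e')) * g by rewrite mulr_ge0//; nra.
    have h2 : 0 <= e' * e' * P0 by rewrite !mulr_ge0// ltW.
    by rewrite -/s; lra.
  apply: le_trans (le_tot key) _.
  rewrite totD; last 2 first.
  + by move=> ab; rewrite mulr_ge0// mulr_ge0// ltW.
  + by move=> ab; rewrite mulr_ge0.
  rewrite totZ ?mulr_ge0 ?(ltW e'0)// tU -EFinM.
  apply: le_trans (leeD2l _ lP) _.
  by rewrite -EFinD lee_fin; lra.
- move=> a b pp; rewrite /D /tau; case: insubP => [c _ cb|_]; last first.
    rewrite big1 ?mulr0; last by move=> w _; rewrite mulr0.
    by rewrite !mulr_ge0 ?invr_ge0 ?mulr_ge0// ltW.
  have PAp : 0 < PA a by exact: lt_le_trans (pmf_le_fst a b).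
  have PBp : 0 < PB b by exact: lt_le_trans (pmf_le_snd a b).
  have := mean_wins_le q0 q1 (NJ a) (sG a) (Some c); rewrite nG /= cb => h.
  under eq_bigr do rewrite (mulrA _ _ ((1 - q) / PB b)).
  rewrite -mulr_suml.
  have d0 : 0 < 1 - q ^+ G by rewrite subr_gt0.
  have k0 : 0 <= (1 - q) / PB b by rewrite divr_ge0// subr_ge0 ltW.
  have h2 := ler_wpM2r k0 h.
  apply: le_trans (ler_wpM2l (PA0 a) h2) _.
  have m2 : (m a b)%:R / (1 - q ^+ G) * ((m a b)%:R / G%:R) <=
      G%:R * rho a b / (1 - q ^+ G) * rho a b.
    apply: ler_pM.
    - by rewrite divr_ge0// ltW.
    - by rewrite divr_ge0.
    - by rewrite ler_wpM2r// invr_ge0 ltW.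
    - by rewrite ler_pdivrMr// mulrC.
  have := ler_wpM2l (PA0 a) (ler_wpM2r k0 m2) => /le_trans; apply.
  have -> : PA a * (G%:R * rho a b / (1 - q ^+ G) * rho a b * ((1 - q) / PB b)) =
    (G%:R * (1 - q) / (1 - q ^+ G)) * (p (a, b) * (p (a, b) / (PA a * PB b))).
    by rewrite /rho; field; rewrite !gt_eqF.
  rewrite -[leRHS]mulrA ler_wpM2r//.
    by rewrite mulr_ge0// divr_ge0// mulr_ge0.
  rewrite ler_pdivrMr//.
  have := subr1_expr_ge q0 q1 G; rewrite mulrAC.
  set x := G%:R * (1 - q) => hx.
  have x0 : 0 <= x by rewrite mulr_ge0// subr_ge0 ltW.
  have : 1 <= (1 + eps) * q ^+ G.
    apply: (@le_trans _ _ ((1 + eps) * (1 - e'))); last by rewrite ler_wpM2l// ltW.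
    by rewrite mulrBr mulr1; lra.
  move=> h1; have := ler_wpM2l x0 h1; have := ler_wpM2l (ltW eps1) hx; lra.
- move=> b phi Phi PBp phi0 Phi0 tel; rewrite /V /tau.
  case: insubP => [c _ cb|_]; last first.
    by rewrite big1 ?mulr_ge0 ?Phi0// => w _; rewrite mul0r mulr0.
  pose h := (1 - q) / PB b.
  have h0 : 0 < h by rewrite divr_gt0// subr_gt0.
  rewrite (@sum_clocks_coord _ q _ J (Some c) (fun j => (j < J)%N%:R * phi (j.+1%:R * h))).
  rewrite (sum_geo q J (fun j => (j < J)%N%:R * phi (j.+1%:R * h))) ltnn mul0r mulr0 addr0.
  (* Each tick has probability at most [1 - q = PB b * h], so the mean is at most [PB b] times a
     right Riemann sum of step [h]. *)
  apply: (@le_trans _ _ (\sum_(j < J) PB b * (Phi (j%:R * h) - Phi (j.+1%:R * h)))).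
    apply: ler_sum => j _; rewrite ltn_ord mul1r.
    have -> : 1 - q = PB b * h by rewrite /h mulrC divfK// gt_eqF.
    have xh : 0 <= j%:R * h by rewrite mulr_ge0// ltW.
    have := tel _ _ xh h0; rewrite -[X in _ + X]mul1r -mulrDl natr1 => t.
    apply: le_trans (ler_wpM2l (PB0 b) t).
    have -> : PB b * h * q ^+ j * phi (j.+1%:R * h) =
        PB b * (h * phi (j.+1%:R * h)) * q ^+ j by ring.
    have qj : q ^+ j <= 1 by rewrite exprn_ile1 ?ltW.
    have w0 := mulr_ge0 (PB0 b) (mulr_ge0 (ltW h0) (phi0 (j.+1%:R * h))).
    by rewrite ler_piMr.
  rewrite -mulr_sumr ler_wpM2l//.
  rewrite -(big_mkord xpredT (fun j => Phi (j%:R * h) - Phi (j.+1%:R * h))).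
  under eq_bigr do rewrite -opprB.
  rewrite sumrN telescope_sumr// opprB mul0r lerBlDr lerDl Phi0//.
  by rewrite mulr_ge0// ltW.
Qed.

End RaceCoupling.

(** * Coding given the clocks *)

Section Pickle.
Variables (R : realType) (Om : finType).

(** Carries a mass function on the finite clock space to [nat], the alphabet of kernels; codes of no
    outcome get mass 0. *)
Definition nat_fun (F : Om -> R) (y : nat) : R :=
  if pickle_inv y is Some w then F w else 0.

Lemma nat_fun_ge0 (F : Om -> R) y : (forall w, 0 <= F w) -> 0 <= nat_fun F y.
Proof. by rewrite /nat_fun => F0; case: pickle_inv. Qed.

Lemma tot_nat_fun (F : Om -> R) : (forall w, 0 <= F w) ->
  tot (nat_fun F) = (\sum_w F w)%:E.
Proof.
move=> F0; rewrite (@tot_seq _ _ [seq pickle w | w <- index_enum Om]).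
- rewrite big_map; congr (_%:E); apply: eq_bigr => w _.
  by rewrite /nat_fun pickleK_inv.
- by rewrite map_inj_uniq ?index_enum_uniq//; exact: pcan_inj pickleK_inv.
- by move=> y; exact: nat_fun_ge0.
- move=> y; rewrite /nat_fun; case E : (pickle_inv y) => [w|]// /mapP; case.
  by exists w; rewrite ?mem_index_enum//; have := @pickle_invK Om y; rewrite /oapp E.
Qed.

End Pickle.

Section CodeBound.
Variables (R : realType) (A B : countType) (p : A * B -> R).
Hypothesis hp : is_pmf p.
Let PA := dist p fst.
Let PB := dist p snd.
Variables (Om : finType) (mu : Om -> R) (D : A -> B -> Om -> bool).
Hypotheses (mu0 : forall w, 0 <= mu w) (mu1 : \sum_w mu w = 1).
Hypothesis Dinj : forall a b b' w, D a b w -> D a b' w -> b = b'.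
Hypothesis Dp : forall a b, PA a * (\sum_w mu w * (D a b w)%:R) <= p (a, b).

Hint Resolve mu0 : core.
Let p0 ab : 0 <= p ab. Proof. by case: hp. Qed.
Hint Resolve p0 : core.
Let PA0 a : 0 <= PA a. Proof. exact: dist_ge0. Qed.
Let PB0 b : 0 <= PB b. Proof. exact: dist_ge0. Qed.

Hint Resolve PA0 PB0 : core.

Let d a b := \sum_w mu w * (D a b w)%:R.
Let d0 a b : 0 <= d a b. Proof. by apply: sumr_ge0 => w _; rewrite mulr_ge0. Qed.
Hint Resolve d0 : core.
Let e ab := p ab - PA ab.1 * d ab.1 ab.2.
Let e0 ab : 0 <= e ab. Proof. by case: ab => a b; rewrite subr_ge0; exact: Dp. Qed.

Hint Resolve e0 : core.

Let undec a w := `[< forall b, ~~ D a b w >].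
Let z a := \sum_w mu w * (undec a w)%:R.
Let z0 a : 0 <= z a. Proof. by apply: sumr_ge0 => w _; rewrite mulr_ge0. Qed.

Hint Resolve z0 : core.

Let tot_D a w : tot (fun b => (D a b w)%:R : R) = (1 - (undec a w)%:R)%:E.
Proof.
rewrite /undec; case: asboolP => [nD|/existsNP[b /negP/negPn Db]].
  rewrite subrr -[RHS](@tot0 _ B); apply: eq_tot => b.
  by rewrite (negPf (nD b)).
rewrite subr0 (@tot_seq _ _ [:: b])//; first by rewrite big_seq1 Db.
move=> b'; rewrite inE; case Db' : (D a b' w) => //.
by rewrite (Dinj Db' Db) eqxx.
Qed.

Let tot_sumw (F : B -> Om -> R) : (forall b w, 0 <= F b w) ->
  tot (fun b => \sum_w mu w * F b w) = (\sum_w (mu w)%:E * tot (F ^~ w))%E.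
Proof.
move=> F0; rewrite /tot; under eq_esum do rewrite -sumEFin.
rewrite esum_sum; last by move=> *; rewrite lee_fin mulr_ge0.
by apply: eq_bigr => w _; rewrite -totZ.
Qed.

Let tot_d a : tot (fun b => d a b) = (1 - z a)%:E.
Proof.
rewrite /d tot_sumw//; under eq_bigr do rewrite tot_D -EFinM.
rewrite sumEFin; congr (_%:E); under eq_bigr do rewrite mulrBr mulr1.
by rewrite sumrB mu1.
Qed.

(** What the selection misses for [a] is exactly the probability of having no winner, so the
    residual law, normalised by [z a], fits the undecided event. *)
Let tot_e a : tot (fun b => e (a, b)) = (PA a * z a)%:E.
Proof.
have := tot_pmf_snd hp a; rewrite -/PA.
rewrite (eq_tot (G := fun b => PA a * d a b + e (a, b))); last first.
  by move=> b; rewrite /e /= addrC subrK.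
rewrite totD ?totZ ?tot_d//; last by move=> b; rewrite mulr_ge0.
have := tot_ge0 (fun b => e0 (a, b)).
case: (tot _) => [x||]// _; rewrite -EFinM -EFinD => -[E]; congr (_%:E).
by move: E; lra.
Qed.

(* Joint law of [(a, b)] and the clocks: when no outcome wins for [a], [b] follows its residual law given [a],
   independently of the clocks. *)
Let jt ab w := mu w * (PA ab.1 * (D ab.1 ab.2 w)%:R + (undec ab.1 w)%:R * (e ab / z ab.1)).

Let jt0 ab w : 0 <= jt ab w.
Proof. by rewrite !mulr_ge0// addr_ge0// mulr_ge0// divr_ge0. Qed.

Let e_z0 a b : z a = 0 -> e (a, b) = 0.
Proof.
move=> za; apply/eqP; rewrite eq_le e0 andbT -lee_fin.
have := tot_e a; rewrite za mulr0 => <-.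
exact: (tot_ge b (fun b => e0 (a, b))).
Qed.

Let mu_undec a w : z a = 0 -> mu w * (undec a w)%:R = 0.
Proof.
move=> /eqP; rewrite psumr_eq0; last by move=> w' _; rewrite mulr_ge0.
by move=> /allP/(_ w); rewrite mem_index_enum => /(_ isT)/eqP.
Qed.

Let sum_jt ab : \sum_w jt ab w = p ab.
Proof.
case: ab => a b; rewrite /jt /=.
under eq_bigr do rewrite mulrDr mulrCA (mulrA (mu _)).
rewrite big_split /= -mulr_sumr -mulr_suml -/(z a) -/(d a b).
have [za|za] := eqVneq (z a) 0.
  by rewrite za mul0r addr0; have := e_z0 b za; rewrite /e /=; lra.
by rewrite mulrC [X in _ + X]mulrC divfK// /e /=; lra.
Qed.

(** This is the independence of [a] and the clocks: at each [w] either the unique winner or the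
    whole residual law carries the mass. *)
Let tot_jt a w : tot (fun b => jt (a, b) w) = (PA a * mu w)%:E.
Proof.
rewrite /jt /= totZ//; last first.
  by move=> b; rewrite addr_ge0 ?mulr_ge0 ?invr_ge0.
rewrite totD; last 2 first.
- by move=> b; rewrite mulr_ge0.
- by move=> b; rewrite !mulr_ge0 ?invr_ge0.
rewrite totZ// tot_D.
have [za|za] := eqVneq (z a) 0.
  rewrite (eq_tot (G := fun=> 0)); last by move=> b; rewrite e_z0// mul0r mulr0.
  rewrite tot0 adde0 -!EFinM; congr (_%:E).
  by have := mu_undec w za; rewrite mulrCA mulrBr mulr1 => ->; rewrite subr0.
rewrite (eq_tot (G := fun b => (undec a w)%:R / z a * e (a, b))); last first.
  by move=> b; rewrite mulrA mulrAC.
have -> : tot (fun b => (undec a w)%:R / z a * e (a, b)) = ((undec a w)%:R * PA a)%:E.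
  by rewrite totZ ?divr_ge0// tot_e -EFinM; congr (_%:E); field.
rewrite -[X in (_ * (X + _))%E]EFinM -[X in (_ * X)%E]EFinD -EFinM.
by congr (_%:E); ring.
Qed.

Let jt_eq0 ab w : p ab = 0 -> jt ab w = 0.
Proof.
move=> pz; have := sum_jt ab; rewrite pz => /eqP.
rewrite psumr_eq0; last by move=> w' _; exact: jt0.
by move=> /allP/(_ w); rewrite mem_index_enum => /(_ isT)/eqP.
Qed.

(** The conditional law of the clocks given [(a, b)]; on null pairs any law serves, and [mu] is
    taken. *)
Definition code_kernel ab (y : nat) : R :=
  nat_fun (fun w => if p ab == 0 then mu w else jt ab w / p ab) y.

Lemma code_kernelP : (forall ab y, 0 <= code_kernel ab y) /\
  (forall ab, \esum_(y in [set: nat]) (code_kernel ab y)%:E = 1%E).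
Proof.
have k0 ab w : 0 <= (if p ab == 0 then mu w else jt ab w / p ab).
  by case: eqP => // _; rewrite divr_ge0.
split=> [ab y|ab]; first exact: nat_fun_ge0.
rewrite -/(tot (code_kernel ab)) tot_nat_fun//; congr (_%:E).
by case: (eqVneq (p ab) 0) => // pn0; rewrite -mulr_suml sum_jt divff.
Qed.

Let J (w : (A * B) * nat) : R := p w.1 * code_kernel w.1 w.2.
Let hJ : is_pmf J := kernel_pmf hp code_kernelP.

Let JE ab y : J (ab, y) = nat_fun (jt ab) y.
Proof.
rewrite /J /code_kernel /nat_fun /=; case: pickle_inv => [w|]; last by rewrite mulr0.
case: (eqVneq (p ab) 0) => [pz|pn0]; first by rewrite pz mul0r jt_eq0.
by rewrite mulrC divfK.
Qed.

Lemma code_kernel_fst a y :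
  dist J (fun w => (w.1.1, w.2)) (a, y) = PA a * nat_fun mu y.
Proof.
have J0 w : 0 <= J w by case: hJ.
apply: EFin_inj; rewrite (distE hJ) tot_pair; last by move=> i; rewrite mulr_ge0.
have E ab : tot (fun y' => (((ab, y').1.1, (ab, y').2) == (a, y))%:R * J (ab, y')) =
    ((ab.1 == a)%:R * J (ab, y))%:E.
  rewrite (@tot_seq _ _ [:: y])//.
  - by rewrite big_seq1 /= xpair_eqE eqxx andbT.
  - by move=> y'; rewrite mulr_ge0.
  - by move=> y'; rewrite inE xpair_eqE /= => /negPf ->; rewrite andbF mul0r.
under eq_esum do rewrite E.
rewrite -/(tot (fun ab => (ab.1 == a)%:R * J (ab, y))).
rewrite (@tot_swap R A B); last by move=> i; rewrite mulr_ge0.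
rewrite tot_pair; last by move=> i; rewrite mulr_ge0.
have E2 b : tot (fun a' => (a' == a)%:R * J ((a', b), y)) = (J ((a, b), y))%:E.
  rewrite (@tot_seq _ _ [:: a])//.
  - by rewrite big_seq1 eqxx mul1r.
  - by move=> y'; rewrite mulr_ge0.
  - by move=> y'; rewrite inE => /negPf ->; rewrite mul0r.
rewrite /=; under eq_esum do rewrite E2.
rewrite -/(tot (fun b => J ((a, b), y))).
under eq_tot do rewrite JE.
rewrite /nat_fun; case: pickle_inv => [w|]; last by rewrite tot0 mulr0.
exact: tot_jt.
Qed.

Lemma code_kernel_snd y : dist J snd y = nat_fun mu y.
Proof.
apply: EFin_inj; rewrite (dist_margin hJ (fun w => w.1.1)).
under eq_tot do rewrite code_kernel_fst mulrC.
rewrite totZ ?nat_fun_ge0//.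
by have -> : tot PA = 1%E by [exact: tot_dist]; rewrite mule1.
Qed.

(* Gibbs' inequality for the code [(1 - delta) c + delta PB]: undecided outcomes are coded with [PB]. *)
Lemma cent_code_kernel_le (c : B -> Om -> R) (delta K : R) :
  0 < delta -> delta < 1 -> 1 <= K ->
  (forall b w, 0 <= c b w) -> (forall b w, c b w <= K) ->
  (tot (fun b => \sum_w mu w * c b w)%R <= 1)%E ->
  (forall a b w, 0 < mu w -> D a b w -> 0 < p (a, b) -> 0 < c b w) ->
  (cent J (fun w => w.1.2) snd + (log2 K)%:E <=
    tot (fun ab => PA ab.1 * \sum_w mu w * (D ab.1 ab.2 w)%:R *
           (log2 K - log2 (c ab.2 w)))%R +
    ((- log2 (1 - delta))%:E +
    tot (fun ab => e ab * (log2 K - log2 (delta * PB ab.2)))%R))%E.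
Proof.
move=> dl0 dl1 K1 c0 cK cm cpos.
have dl1' : 0 < 1 - delta by rewrite subr_gt0.
have J0 w : 0 <= J w by case: hJ.
have K0 : 0 < K by exact: lt_le_trans K1.
have lK0 : 0 <= log2 K by exact: log2_ge0.
have lc b w : log2 (c b w) <= log2 K.
  have := c0 b w; rewrite le_eqVlt => /orP[/eqP<-|cp]; last exact: log2_le.
  by rewrite [log2 0]/log2 ln0// mul0r.
have PB1 b : PB b <= 1 by exact: dist_le1.
have lPB b : log2 (delta * PB b) <= 0.
  by rewrite log2_le0// mulr_ile1 ?(ltW dl0) ?(ltW dl1).
pose inner b w := (1 - delta) * c b w + delta * PB b.
have in0 b w : 0 <= inner b w by rewrite addr_ge0// mulr_ge0// ltW.
have inK b w : inner b w <= K.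
  have := ler_wpM2l (ltW dl1') (cK b w); have := ler_wpM2l (ltW dl0) (PB1 b).
  by have := ler_wpM2l (ltW dl0) K1; rewrite /inner; lra.
have lin b w : log2 (inner b w) <= log2 K.
  have := in0 b w; rewrite le_eqVlt => /orP[/eqP<-|cp]; last exact: log2_le.
  by rewrite [log2 0]/log2 ln0// mul0r.
pose q (by_ : B * nat) := nat_fun (fun w => mu w * inner by_.1 w) by_.2.
have q0 by_ : 0 <= q by_ by apply: nat_fun_ge0 => w; rewrite mulr_ge0.
have q1 : (tot q <= 1)%E.
  rewrite tot_pair// /q /=.
  under eq_esum => b _ do rewrite (tot_nat_fun (fun w => mulr_ge0 (mu0 w) (in0 b w))).
  rewrite -/(tot (fun b => \sum_w mu w * inner b w)).
  rewrite (eq_tot (G := fun b => (1 - delta) * (\sum_w mu w * c b w) + delta * PB b)); last first.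
    move=> b; under eq_bigr do rewrite /inner mulrDr mulrCA.
    by rewrite big_split /= -mulr_sumr -mulr_suml mu1 mul1r.
  rewrite totD; last 2 first.
  - by move=> b; rewrite mulr_ge0 ?(ltW dl1')// sumr_ge0// => w _; rewrite mulr_ge0.
  - by move=> b; rewrite mulr_ge0// ltW.
  have sc0 b : 0 <= \sum_w mu w * c b w by rewrite sumr_ge0// => w _; rewrite mulr_ge0.
  rewrite (totZ (ltW dl1') sc0) (totZ (ltW dl0) PB0).
  have -> : tot PB = 1%E by exact: tot_dist.
  rewrite mule1; apply: (@le_trans _ _ ((1 - delta)%:E * 1 + delta%:E)%E).
    by rewrite leeD2r// lee_wpmul2l// lee_fin ltW.
  by rewrite mule1 -EFinD lee_fin; lra.
(* The weight [c] may exceed 1, so both code lengths are raised by [log2 K] to be nonnegative. *)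
pose H (w : (A * B) * nat) :=
  log2 K - nat_fun (fun v => log2 (inner w.1.2 v)) w.2.
pose G (w : (A * B) * nat) := log2 (dist J snd w.2 /
  dist J (fun w => (w.1.2, w.2)) (w.1.2, w.2)) + log2 K.
have G0 w : 0 <= G w.
  by rewrite addr_ge0//; apply: (log2_ratio_ge0 hJ) => v [].
have H0 w : 0 <= H w.
  by rewrite /H /nat_fun; case: pickle_inv => [v|]; rewrite subr_ge0.
have gb := gibbs hJ (h := fun w => (w.1.2, w.2)) q0 q1 G0 H0.
have {gb} : (tot (fun w => J w * G w)%R <= tot (fun w => J w * H w)%R)%E.
  apply: gb => -[[a b] y] Jw /=.
  have yp := dist_gt0 hJ snd Jw; have byp := dist_gt0 hJ (fun w => (w.1.2, w.2)) Jw.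
  rewrite /= in yp byp; move: Jw (yp); rewrite JE code_kernel_snd /q /G /H /= code_kernel_snd.
  rewrite /nat_fun; case: pickle_inv => [w|]; last by rewrite ltxx.
  move=> jp mp.
  have pp : 0 < p (a, b).
    by rewrite lt_neqAle p0 andbT eq_sym; apply/eqP => /(jt_eq0 w) jz; move: jp; rewrite jz ltxx.
  have PBp : 0 < PB b by exact: lt_le_trans (pmf_le_snd hp a b).
  have inp : 0 < inner b w.
    by rewrite ltr_wpDl ?mulr_gt0// mulr_ge0// ltW.
  split; first exact: mulr_gt0.
  by rewrite !log2_div ?mulr_gt0// log2M//; lra.
have -> : tot (fun w => J w * G w) = (cent J (fun w => w.1.2) snd + (log2 K)%:E)%E.
  rewrite (cent_tot hJ) /G; under eq_tot do rewrite mulrDr [X in _ + X]mulrC.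
  rewrite totD.
  - by rewrite totZ//; case: hJ => _; rewrite -/(tot J) => ->; rewrite mule1.
  - by move=> w; rewrite mulr_ge0//; apply: (log2_ratio_ge0 hJ) => v [].
  - by move=> w; rewrite mulr_ge0.
move=> /le_trans; apply.
rewrite tot_pair; last by move=> w; rewrite mulr_ge0.
have tJH ab : tot (fun y => J (ab, y) * H (ab, y)) =
    (\sum_w jt ab w * (log2 K - log2 (inner ab.2 w)))%:E.
  rewrite -tot_nat_fun; last by move=> w; rewrite mulr_ge0// subr_ge0.
  apply: eq_tot => y; rewrite JE /H /= /nat_fun.
  by case: pickle_inv => // ; rewrite mul0r.
under eq_esum do rewrite tJH.
pose l1 := - log2 (1 - delta).
have l10 : 0 <= l1 by rewrite oppr_ge0 log2_le0//; lra.
pose t1 ab := PA ab.1 * \sum_w mu w * (D ab.1 ab.2 w)%:R * (log2 K - log2 (c ab.2 w)).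
pose t2 ab := l1 * (PA ab.1 * d ab.1 ab.2).
pose t3 ab := e ab * (log2 K - log2 (delta * PB ab.2)).
have t10 ab : 0 <= t1 ab.
  by rewrite mulr_ge0// sumr_ge0// => w _; rewrite !mulr_ge0// subr_ge0.
have t20 ab : 0 <= t2 ab by rewrite !mulr_ge0.
have t30 ab : 0 <= t3 ab by rewrite mulr_ge0// subr_ge0 (le_trans (lPB _)).
(* A decided outcome pays for [(1 - delta) * c], that is, [l1] more than for [c]; an undecided one
   pays at most for [delta * PB]. *)
have main ab : \sum_w jt ab w * (log2 K - log2 (inner ab.2 w)) <= t1 ab + (t2 ab + t3 ab).
  case: ab => a b /=.
  have [pz|pn0] := eqVneq (p (a, b)) 0.
    rewrite big1; last by move=> w _; rewrite jt_eq0// mul0r.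
    by rewrite !addr_ge0.
  have pp : 0 < p (a, b) by rewrite lt_neqAle p0 andbT eq_sym.
  have PBp : 0 < PB b by exact: lt_le_trans (pmf_le_snd hp a b).
  have undec_le w : (undec a w)%:R * (log2 K - log2 (inner b w)) <=
      (undec a w)%:R * (log2 K - log2 (delta * PB b)).
    rewrite ler_wpM2l// lerD2l lerN2 log2_le ?mulr_gt0//.
    by rewrite lerDr mulr_ge0// ltW.
  have D_le w : mu w * (D a b w)%:R * (log2 K - log2 (inner b w)) <=
      mu w * (D a b w)%:R * (log2 K - log2 (c b w)) + l1 * (mu w * (D a b w)%:R).
    have := mu0 w; rewrite le_eqVlt => /orP[/eqP<-|mp]; first by rewrite !mul0r mulr0 addr0.
    case Db : (D a b w); last by rewrite !mulr0 !mul0r addr0.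
    have cp := cpos a b w mp Db pp.
    rewrite mulr1 [l1 * _]mulrC -mulrDr ler_wpM2l//.
    have : log2 ((1 - delta) * c b w) <= log2 (inner b w).
      by rewrite log2_le ?mulr_gt0// lerDl mulr_ge0// ltW.
    by rewrite log2M// /l1; lra.
  rewrite /t1 /t2 /t3 /d /=.
  have S1 : PA a * (\sum_w mu w * (D a b w)%:R * (log2 K - log2 (inner b w))) <=
      PA a * \sum_w (mu w * (D a b w)%:R * (log2 K - log2 (c b w)) +
        l1 * (mu w * (D a b w)%:R)).
    by rewrite ler_wpM2l// ler_sum.
  have S2 : \sum_w mu w * ((undec a w)%:R * (e (a, b) / z a)) * (log2 K - log2 (inner b w)) <=
     e (a, b) * (log2 K - log2 (delta * PB b)).
    apply: (@le_trans _ _ (\sum_w mu w * (undec a w)%:R *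
      (e (a, b) / z a * (log2 K - log2 (delta * PB b))))).
      apply: ler_sum => w _; rewrite -!mulrA ler_wpM2l//.
      rewrite mulrCA [leRHS]mulrCA ler_wpM2l//.
      by rewrite mulrCA [leRHS]mulrCA ler_wpM2l ?invr_ge0.
    rewrite -mulr_suml -/(z a).
    have [za|za] := eqVneq (z a) 0.
      by rewrite za mul0r mulr_ge0// subr_ge0 (le_trans (lPB _)).
    by rewrite mulrA mulrCA divff// mulr1.
  have -> : \sum_w jt (a, b) w * (log2 K - log2 (inner b w)) =
    PA a * (\sum_w mu w * (D a b w)%:R * (log2 K - log2 (inner b w))) +
    \sum_w mu w * ((undec a w)%:R * (e (a, b) / z a)) * (log2 K - log2 (inner b w)).
    rewrite mulr_sumr -big_split /=; apply: eq_bigr => w _; rewrite /jt /=; ring.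
  apply: le_trans (lerD S1 S2) _.
  rewrite big_split /= -mulr_sumr; lra.
rewrite -[leLHS]/(tot (fun ab => \sum_w jt ab w * (log2 K - log2 (inner ab.2 w)))).
apply: le_trans (le_tot main) _.
rewrite totD//; last by move=> ab; rewrite addr_ge0.
rewrite totD// leeD2l// leeD2r// /t2 totZ//; last by move=> ab; rewrite mulr_ge0.
rewrite -[leRHS]mule1 lee_wpmul2l ?lee_fin//.
have <- : tot p = 1%E by case: hp.
by apply: le_tot => -[a b]; exact: Dp.
Qed.

End CodeBound.

(** * The power-law weight and its constants *)

Section PowerLaw.
Variables (R : realType) (k s : R).
Hypotheses (k0 : 0 < k) (s0 : 0 < s).

Definition powlaw (t : R) : R := expR (- (1 + s) * ln (k + t)).
(** The integral of [powlaw] from [t] to infinity; its value at 0 normalises the code. *)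
Definition powlaw_tail (t : R) : R := expR (- s * ln (k + t)) / s.

Lemma powlaw_ge0 t : 0 <= powlaw t. Proof. exact: expR_ge0. Qed.

Lemma powlaw_tail_gt0 t : 0 < powlaw_tail t.
Proof. by rewrite divr_gt0// expR_gt0. Qed.

(** The Riemann comparison that [race_coupling] asks of [phi] and [Phi]; it reduces to
    [ln x <= x - 1] followed by [1 + x <= expR x]. *)
Lemma powlaw_step t h : 0 <= t -> 0 < h ->
  h * powlaw (t + h) <= powlaw_tail t - powlaw_tail (t + h).
Proof.
move=> t0 h0; rewrite /powlaw /powlaw_tail addrA.
set a := k + t; have a0 : 0 < a by rewrite ltr_wpDr.
have b0 : 0 < a + h by rewrite addr_gt0.
set b := a + h.
have lab : 1 - a / b <= ln b - ln a.
  have := ln_le_subr1 (divr_gt0 a0 b0); rewrite ln_div ?posrE//; lra.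
have lb : 1 + s * (1 - a / b) <= expR (s * (ln b - ln a)).
  apply: le_trans (expR_ge1Dx _); rewrite lerD2l ler_wpM2l//; exact: ltW.
have e1 : expR (- (1 + s) * ln b) = expR (- s * ln b) / b.
  have -> : - (1 + s) * ln b = - s * ln b + - ln b by ring.
  by rewrite expRD expRN lnK ?posrE.
have e2 : expR (- s * ln a) = expR (- s * ln b) * expR (s * (ln b - ln a)).
  by rewrite -expRD; congr expR; ring.
rewrite e1 e2.
have E0 : 0 < expR (- s * ln b) by exact: expR_gt0.
rewrite -mulrBl -[X in _ - X]mulr1 -mulrBr -mulrA mulrCA ler_wpM2l ?(ltW E0)//.
rewrite ler_pdivlMr//.
have hb : h = b - a by rewrite /b addrC addKr.
have : h / b = 1 - a / b by rewrite {1}hb mulrBl divff// gt_eqF.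
by move=> ->; lra.
Qed.

Lemma powlaw_le t : 0 <= t -> powlaw t / powlaw_tail 0 <= s / k.
Proof.
move=> t0; rewrite /powlaw /powlaw_tail addr0 invf_div mulrCA ler_wpM2l ?(ltW s0)//.
have -> : k^-1 = expR (- ln k) by rewrite expRN lnK ?posrE.
rewrite -expRN -expRD ler_expR.
have : ln k <= ln (k + t) by rewrite ler_ln ?posrE ?ltr_wpDr// lerDl.
move=> h; have := ler_wpM2l (ltW s0) h; lra.
Qed.

Lemma ln_powlaw t : ln (powlaw t / powlaw_tail 0) = - (1 + s) * ln (k + t) + s * ln k + ln s.
Proof.
rewrite ln_div ?posrE ?expR_gt0 ?powlaw_tail_gt0//.
by rewrite ln_div ?posrE ?expR_gt0// !expRK addr0; lra.
Qed.

End PowerLaw.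

Section PowerLawCost.
Variables (R : realType) (Om : finType) (mu : Om -> R) (D : Om -> bool) (tau : Om -> R).
Hypotheses (mu0 : forall w, 0 <= mu w) (tau0 : forall w, 0 <= tau w).
Variables (a b p k t eta : R).
Hypotheses (a0 : 0 < a) (b0 : 0 < b) (p0 : 0 < p) (k0 : 0 < k) (t0 : 0 <= t).
Let r := p / (a * b).
Let m := a * \sum_w mu w * (D w)%:R.
Hypothesis mp : m <= p.
Hypothesis mtau : a * (\sum_w mu w * (D w)%:R * tau w) <= (1 + eta) * p * r.

(* [t * ln (k + tau)] is linearised at [(1 + k) * r]. *)
Lemma powlaw_cost (Z : R) :
  a * (\sum_w mu w * (D w)%:R * (Z + t * (1 - ln (1 + k) + ln (k + tau w)))) <=
  Z * p + t * (p * ln r) + (p - m) * (`|Z| + t * r^-1) +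
  t / (1 + k) * (k * (a * b) + (1 + eta) * p).
Proof.
have r0 : 0 < r by rewrite /r divr_gt0// mulr_gt0.
have k1 : 0 < 1 + k by rewrite addr_gt0.
(* The slope of the tangent at [(1 + k) * r]. That point is chosen because summing [k * (a * b) + p]
   over all pairs gives [k + 1], which cancels the denominator [1 + k]. *)
pose y := t / (1 + k) / r.
have y0 : 0 <= y := divr_ge0 (divr_ge0 t0 (ltW k1)) (ltW r0).
have lin w : Z + t * (1 - ln (1 + k) + ln (k + tau w)) <=
    Z + t * ln r + y * (k + tau w).
  have kt : 0 < k + tau w by rewrite ltr_wpDr.
  have := ln_le_subr1 (divr_gt0 kt (mulr_gt0 k1 r0)).
  rewrite ln_div ?posrE ?(mulr_gt0 k1 r0)// lnM ?posrE// => h.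
  have -> : y * (k + tau w) = t * ((k + tau w) / ((1 + k) * r)).
    by rewrite /y; field; rewrite !gt_eqF.
  rewrite -[leRHS]addrA lerD2l -mulrDr ler_wpM2l//; move: h; lra.
have S : a * (\sum_w mu w * (D w)%:R * (Z + t * (1 - ln (1 + k) + ln (k + tau w)))) <=
    m * (Z + t * ln r + y * k) + y * (a * (\sum_w mu w * (D w)%:R * tau w)).
  have -> : m * (Z + t * ln r + y * k) + y * (a * (\sum_w mu w * (D w)%:R * tau w)) =
      a * \sum_w mu w * (D w)%:R * (Z + t * ln r + y * (k + tau w)).
    rewrite [in RHS](eq_bigr (fun w => mu w * (D w)%:R * (Z + t * ln r + y * k) +
      y * (mu w * (D w)%:R * tau w))); last by move=> w _; ring.
    by rewrite big_split /= -mulr_suml -mulr_sumr /m; ring.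
  rewrite ler_wpM2l ?(ltW a0)// ler_sum// => w _.
  by rewrite ler_wpM2l// mulr_ge0.
apply: (le_trans S).
have h1 := ler_wpM2l y0 mtau.
have h2 := ler_wpM2l (mulr_ge0 y0 (ltW k0)) mp.
have yr : y * r = t / (1 + k) by rewrite /y divfK// gt_eqF.
have yp : y * p = t / (1 + k) * (a * b).
  by rewrite /y /r; field; rewrite !gt_eqF.
have d0 : 0 <= p - m by rewrite subr_ge0.
have lr : - ln r <= r^-1.
  have ri : 0 < r^-1 by rewrite invr_gt0.
  by have := ln_le_subr1 ri; rewrite lnV ?posrE//; lra.
(* Replacing [m] by [p] is not monotone, as [Z + t * ln r] has no sign; the correction is charged to
   the missing mass, through [- ln r <= r^-1]. *)
have h3 : (p - m) * - (Z + t * ln r) <= (p - m) * (`|Z| + t * r^-1).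
  rewrite ler_wpM2l// opprD; apply: lerD.
    by rewrite -normrN ler_norm.
  by rewrite -mulrN ler_wpM2l.
set X := a * (\sum_w mu w * (D w)%:R * tau w) in h1 *.
move: X (t / (1 + k)) h1 h2 h3 yr yp => X v h1 h2 h3 yr yp.
have -> : v * (k * (a * b) + (1 + eta) * p) = y * k * p + y * ((1 + eta) * p * r).
  rewrite [v * _]mulrDr -yr; have -> : y * r * (k * (a * b)) = k * (v * (a * b)) by rewrite yr; ring.
  by rewrite -yp; ring.
move: (ln r) h1 h2 h3 => lr' h1 h2 h3; lra.
Qed.

End PowerLawCost.

Section Constants.
Variable R : realType.

Lemma half_le_ln2 : 2^-1 <= ln 2 :> R.
Proof.
have h : 0 < 2^-1 :> R by rewrite invr_gt0.
by have := ln_le_subr1 h; rewrite lnV ?posrE//; lra.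
Qed.

Lemma ln41_le : ln 41%:R <= 551%:R / 100%:R * ln 2 :> R.
Proof.
have : ln (41%:R ^+ 2) <= ln (2 ^+ 11) :> R.
  by rewrite ler_ln ?posrE ?exprn_gt0// -!natrX ler_nat.
rewrite !lnXn// -[ln 41%:R *+ 2]mulr_natl -[ln 2 *+ 11]mulr_natl.
by have := @ln2_gt0 R; lra.
Qed.

(** For [c = 5.51], [s] minimises [s (I + c) - log2 s], and [k = 1/40] keeps
    [log2 ((1 + k) / k) = log2 41] below [c]. At this [s] the first term is [1 / ln 2], which
    cancels against [ln (ln 2) / ln 2 <= 1 - 1 / ln 2]; there remains [1 + k / ln 2], at most
    1.05. *)
Lemma sfrl_constants (I : R) : 0 <= I -> exists k s : R, [/\ 0 < k, 0 < s &
  (1 + s) * I + ((1 + s) * ln (1 + k) - s * ln k - ln s) / ln 2 <=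
  I + (log2 (I + 551%:R / 100%:R) + 106%:R / 100%:R)].
Proof.
move=> I0; pose L : R := ln 2; pose k : R := 40%:R^-1.
pose s := (I * L + 551%:R / 100%:R * L)^-1; exists k, s.
have L0 : 0 < L := @ln2_gt0 R.
have Lh : 2^-1 <= L := half_le_ln2.
have J0 : 0 < I + 551%:R / 100%:R by lra.
have sE : s = ((I + 551%:R / 100%:R) * L)^-1 by rewrite /s; congr (_^-1); ring.
have X0 : 0 < (I + 551%:R / 100%:R) * L by rewrite mulr_gt0.
have s0 : 0 < s by rewrite sE invr_gt0.
have lns : - ln s = ln (I + 551%:R / 100%:R) + ln L.
  by rewrite sE lnV ?posrE// opprK lnM ?posrE.
have k0 : 0 < k by rewrite invr_gt0 ltr0n.
have lk : ln (1 + k) <= k by apply: le_ln1Dx; lra.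
have lk2 : ln (1 + k) - ln k <= 551%:R / 100%:R * L.
  rewrite -ln_div ?posrE ?addr_gt0//.
  have -> : (1 + k) / k = 41%:R by rewrite /k; field.
  exact: ln41_le.
have lL : ln L <= L - 1 by exact: ln_le_subr1.
have sX : s * (I * L + 551%:R / 100%:R * L) = 1 by rewrite sE -mulrDl mulVf ?gt_eqF.
have h := ler_wpM2l (ltW s0) lk2.
split=> //.
rewrite -(ler_pM2r L0) mulrDl divfK ?gt_eqF//.
rewrite [leRHS]mulrDl [X in _ <= _ + X]mulrDl /log2 -/L divfK ?gt_eqF//.
have kE : k = 1 / 40%:R by rewrite /k div1r.
rewrite lns; move: kE h sX lk lL Lh; clear.
move: (ln (1 + k)) (ln k) (ln L) (ln (I + _)) => l1 lk lL lI.
by move: L s k => L' s' k'; lra.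
Qed.

End Constants.

Lemma tot_unique_le1 (R : realType) (I : choiceType) (Q : I -> bool) :
  (forall i j, Q i -> Q j -> i = j) -> (tot (fun i => (Q i)%:R : R) <= 1)%E.
Proof.
move=> Qinj; have [[i Qi]|nQ] := pselect (exists i, Q i); last first.
  rewrite (eq_tot (G := fun=> 0)) ?tot0// => i.
  by case Qi : (Q i) => //; case: nQ; exists i.
rewrite (@tot_seq _ _ [:: i])//; first by rewrite big_seq1 Qi.
by move=> j; rewrite inE; case Qj : (Q j) => //; rewrite (Qinj _ _ Qj Qi) eqxx.
Qed.

(** * Kernels independent of [A] that nearly determine [B] *)

Section FunctionalRepresentation.
Variables (R : realType) (A B : countType) (p : A * B -> R).
Hypothesis hp : is_pmf p.
Hypothesis HB : (ent p snd < +oo)%E.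
Let PA := dist p fst.
Let PB := dist p snd.

Let p0 ab : 0 <= p ab. Proof. by case: hp. Qed.
Let PA0 a : 0 <= PA a. Proof. exact: dist_ge0. Qed.
Let PB0 b : 0 <= PB b. Proof. exact: dist_ge0. Qed.
Hint Resolve p0 PA0 PB0 : core.
Let lPA0 a : 0 <= - log2 (PA a). Proof. by rewrite oppr_ge0 log2_le0// dist_le1. Qed.
Let lPB0 b : 0 <= - log2 (PB b). Proof. by rewrite oppr_ge0 log2_le0// dist_le1. Qed.
Hint Resolve lPA0 lPB0 : core.

Let tot_p : tot p = 1%E. Proof. by case: hp. Qed.
Let tot_PB : tot PB = 1%E. Proof. exact: tot_dist. Qed.

Let log2_1Bdelta (eps : R) : 0 < eps ->
  exists delta : R, [/\ 0 < delta, delta < 1 & - log2 (1 - delta) = eps].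
Proof.
move=> e0; exists (1 - expR (- eps * ln 2)).
have L0 := @ln2_gt0 R; have eL : 0 < eps * ln 2 by rewrite mulr_gt0.
split.
- by rewrite subr_gt0 expR_lt1 mulNr oppr_lt0.
- by rewrite ltrBlDr ltrDl expR_gt0.
- by rewrite opprB addrC subrK /log2 expRK !mulNr opprK mulfK// gt_eqF.
Qed.

Definition indep_kernel (q : A * B -> nat -> R) :=
  [/\ (forall ab y, 0 <= q ab y),
      (forall ab, \esum_(y in [set: nat]) (q ab y)%:E = 1%E) &
      forall a y, dist (fun w => p w.1 * q w.1 w.2) (fun w => (w.1.1, w.2)) (a, y) =
        PA a * dist (fun w => p w.1 * q w.1 w.2) snd y].

Lemma code_kernel_indep (Om : finType) (mu : Om -> R) (D : A -> B -> Om -> bool) :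
  (forall w, 0 <= mu w) -> \sum_w mu w = 1 ->
  (forall a b b' w, D a b w -> D a b' w -> b = b') ->
  (forall a b, PA a * (\sum_w mu w * (D a b w)%:R) <= p (a, b)) ->
  indep_kernel (code_kernel p mu D).
Proof.
move=> mu0 mu1 Dinj Dp.
have [k0 k1] := code_kernelP hp mu0 mu1 Dinj Dp.
split=> // a y; rewrite (code_kernel_fst hp mu0 mu1 Dinj Dp).
by rewrite (code_kernel_snd hp mu0 mu1 Dinj Dp).
Qed.

Lemma indep_kernel_ent (eps : R) : 0 < eps -> exists q, indep_kernel q /\
  (cent (fun w => (p w.1 * q w.1 w.2)%R) (fun w => w.1.2) snd <= ent p fst + eps%:E)%E.
Proof.
move=> eps0; have e2 : 0 < eps / 2 by rewrite divr_gt0.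
have [dl [dl0 dl1 dlE]] := log2_1Bdelta e2.
(* The code length of an undecided outcome; its mean is finite because [H(B)] is. *)
pose u (ab : A * B) := - log2 (dl * PB ab.2).
have u0 ab : 0 <= u ab.
  by rewrite oppr_ge0 log2_le0// mulr_ile1 ?dist_le1// ltW.
have pu : (tot (fun ab => p ab * u ab)%R < +oo)%E.
  have ldl0 : 0 <= - log2 dl by rewrite oppr_ge0 log2_le0// ltW.
  apply: (@le_lt_trans _ _ (tot (fun ab => - log2 dl * p ab + p ab * - log2 (PB ab.2)))).
    apply: le_tot => -[a b]; have := p0 (a, b); rewrite le_eqVlt => /orP[/eqP<-|pp].
      by rewrite mulr0 !mul0r addr0.
    rewrite [- _ * _]mulrC -mulrDr ler_wpM2l// /u log2M ?opprD//=.
    exact: lt_le_trans (pmf_le_snd hp a b).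
  rewrite totD; [|by move=> ab; rewrite mulr_ge0|by move=> ab; rewrite mulr_ge0].
  rewrite totZ// tot_p mule1 -(ent_tot hp snd).
  by rewrite lte_add_pinfty// ltry.
have [Om [mu [D [tau [V [[mu0 mu1] [Dinj _] [Dp De] _ _]]]]]] :=
  race_coupling hp u0 e2 pu.
exists (code_kernel p mu D); split; first exact: code_kernel_indep.
have tc b w : (tot (fun a => PA a * (D a b w)%:R)%R <= 1)%E.
  rewrite -(tot_dist hp fst); apply: le_tot => a.
  by rewrite ler_piMr// lern1 leq_b1.
have tc0 b w : (0 <= tot (fun a => PA a * (D a b w)%:R)%R)%E.
  by apply: tot_ge0 => a; rewrite mulr_ge0.
(* The law of the outcome that a fresh [a] would select under [w]. If [a] selects [b] this is at
   least [PA a], so the code length is at most that of [a]. *)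
pose c b w := fine (tot (fun a => PA a * (D a b w)%:R)).
have cE b w : (c b w)%:E = tot (fun a => PA a * (D a b w)%:R).
  by rewrite fineK// ge0_fin_numE// (le_lt_trans (tc b w))// ltry.
have c0 b w : 0 <= c b w by rewrite -lee_fin cE.
have c1 b w : c b w <= 1 by rewrite -lee_fin cE.
have cge a b w : D a b w -> PA a <= c b w.
  move=> Dw; rewrite -lee_fin cE.
  apply: le_trans (tot_ge a _); first by rewrite Dw mulr1.
  by move=> a'; rewrite mulr_ge0.
have cm : (tot (fun b => \sum_w mu w * c b w)%R <= 1)%E.
  rewrite /tot; under eq_esum do rewrite -sumEFin.
  rewrite esum_sum; last by move=> *; rewrite lee_fin mulr_ge0.
  apply: (@le_trans _ _ (\sum_w (mu w)%:E)%E); last by rewrite sumEFin mu1.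
  apply: lee_sum => w _.
  rewrite -/(tot (fun b => mu w * c b w)) totZ//.
  rewrite -[leRHS]mule1 lee_wpmul2l ?lee_fin//.
  rewrite /tot; under eq_esum do rewrite cE.
  rewrite -(tot_pair (F := fun ba => PA ba.2 * (D ba.2 ba.1 w)%:R)); last first.
    by move=> ba; rewrite mulr_ge0.
  rewrite tot_swap /=; last by move=> ba; rewrite mulr_ge0.
  rewrite tot_pair /=; last by move=> ba; rewrite mulr_ge0.
  rewrite -(tot_dist hp fst); apply: le_esum => a _.
  rewrite totZ// -[leRHS]mule1 lee_wpmul2l ?lee_fin//.
  by apply: tot_unique_le1 => b b'; exact: Dinj.
have cpos a b w : 0 < mu w -> D a b w -> 0 < p (a, b) -> 0 < c b w.
  move=> _ Dw pp; apply: lt_le_trans (cge _ _ _ Dw).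
  exact: lt_le_trans (pmf_le_fst hp a b).
have := cent_code_kernel_le hp mu0 mu1 Dinj Dp dl0 dl1 (lexx 1) c0 c1 cm cpos.
have -> : log2 1 = 0 :> R by rewrite /log2 ln1 mul0r.
rewrite adde0 dlE => /le_trans; apply.
rewrite [X in (_ <= _ + X%:E)%E](splitr eps) EFinD; apply: leeD; last first.
  by rewrite leeD2l//; apply: le_trans De; apply: le_tot => ab; rewrite sub0r.
rewrite (ent_tot hp); apply: le_tot => -[a b] /=.
have := PA0 a; rewrite /PA le_eqVlt => /orP[/eqP a0|a0].
  by rewrite -a0 mul0r mulr_ge0// oppr_ge0 log2_le0// ler01.
apply: le_trans (ler_wpM2r (lPA0 a) (Dp a b)).
rewrite -mulrA ler_wpM2l// mulr_suml ler_sum// => w _.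
case Db : (D a b w); last by rewrite mulr0 !mul0r.
by rewrite ler_wpM2l ?mulr1// sub0r lerN2 log2_le// cge.
Qed.

(** A power-law code spends about [(1 + s) log2 (tau b)] bits, and [tau b] has mean about
    [p / (PA PB)] at a selected pair: this yields [(1 + s) I] plus the normalisation. *)
Lemma indep_kernel_mi (eps : R) : 0 < eps ->
  let I := fine (ent p snd) - fine (cent p snd fst) in
  exists q, indep_kernel q /\
  (cent (fun w => (p w.1 * q w.1 w.2)%R) (fun w => w.1.2) snd <=
    (I + (log2 (I + 551%:R / 100%:R) + 106%:R / 100%:R) + eps)%:E)%E.
Proof.
move=> eps0 I.
have hb_fin : ent p snd \is a fin_num by rewrite ge0_fin_numE// ent_ge0.
have cb_fin : cent p snd fst \is a fin_num.
  by rewrite ge0_fin_numE ?cent_ge0// (le_lt_trans (cent_le_ent hp _ _)).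
have I0 : 0 <= I by rewrite subr_ge0 fine_le// cent_le_ent.
have [k [s [k0 s0]]] := sfrl_constants I0.
move: (I + (log2 _ + _)) => bound boundE.
pose L : R := ln 2; have L0 : 0 < L := ln2_gt0 R.
have k1 : 0 < 1 + k by rewrite addr_gt0.
have s1 : 0 < 1 + s by rewrite addr_gt0.
pose t := (1 + s) / L; have t0 : 0 <= t := divr_ge0 (ltW s1) (ltW L0).
pose K := Num.max 1 (s / k).
have K1 : 1 <= K by rewrite le_max lexx.
have lK0 : 0 <= log2 K by exact: log2_ge0.
(* The constant part of [log2 K - log2 c] in the shape expected by [powlaw_cost]; see [lc]. *)
pose Z := log2 K + ((1 + s) * (ln (1 + k) - 1) - s * ln k - ln s) / L.
pose r (ab : A * B) := p ab / (PA ab.1 * PB ab.2).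
have PAPB0 ab : 0 <= PA ab.1 * PB ab.2 by rewrite mulr_ge0.
have r0 ab : 0 <= r ab by exact: divr_ge0 (p0 ab) (PAPB0 ab).
(* The deficit costs [eta] and the inflated mean of [tau] costs [t * eta]; together they use
   [eps / 2], and mixing the code with [PB] uses the other half. *)
have [eta eta0 etaE] : exists2 eta : R, 0 < eta & (t + 1) * eta = eps / 2.
  have t1 : 0 < t + 1 by rewrite ltr_wpDl.
  exists (eps / 2 / (t + 1)); first by rewrite !divr_gt0.
  by rewrite mulrC divfK// gt_eqF.
have e2 : 0 < eps / 2 by rewrite divr_gt0.
have [dl [dl0 dl1 dlE]] := log2_1Bdelta e2.
(* [u1] prices the coding of undecided outcomes, [u2] the correction term of [powlaw_cost]; one
   coupling controls both. *)
pose u1 (ab : A * B) := log2 K - log2 (dl * PB ab.2).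
pose u2 ab := `|Z| + t * (r ab)^-1.
pose u ab := u1 ab + u2 ab.
have u10 ab : 0 <= u1 ab.
  by rewrite /u1 addr_ge0// oppr_ge0 log2_le0// mulr_ile1 ?dist_le1// ltW.
have u20 ab : 0 <= u2 ab by rewrite /u2 addr_ge0// mulr_ge0// invr_ge0.
have u0 ab : 0 <= u ab by rewrite /u addr_ge0.
have pr_le ab : p ab / r ab <= PA ab.1 * PB ab.2.
  have [pz|pn0] := eqVneq (p ab) 0; first by rewrite pz mul0r.
  by rewrite /r invf_div mulrCA divff// mulr1.
have tPAPB : tot (fun ab => PA ab.1 * PB ab.2) = 1%E by exact: tot_dist_prod.
have pu : (tot (fun ab => p ab * u ab)%R < +oo)%E.
  have ldl0 : 0 <= - log2 dl by rewrite oppr_ge0 log2_le0// ltW.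
  pose cst := log2 K + `|Z| - log2 dl.
  have cst0 : 0 <= cst by rewrite !addr_ge0.
  have q10 ab : 0 <= cst * p ab by rewrite mulr_ge0.
  have q20 ab : 0 <= p ab * - log2 (PB ab.2) by rewrite mulr_ge0.
  have q30 ab : 0 <= t * (PA ab.1 * PB ab.2) by rewrite mulr_ge0.
  apply: (@le_lt_trans _ _ (tot (fun ab => cst * p ab + (p ab * - log2 (PB ab.2) +
      t * (PA ab.1 * PB ab.2))))).
    apply: le_tot => -[a b]; have := p0 (a, b); rewrite le_eqVlt => /orP[/eqP pz|pp].
      by rewrite -pz mulr0 !mul0r !add0r.
    have PBp : 0 < PB b := lt_le_trans pp (pmf_le_snd hp a b).
    have := ler_wpM2l t0 (pr_le (a, b)).
    rewrite /u /u1 /u2 /cst log2M//=; lra.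
  rewrite totD//; last by move=> ab; rewrite addr_ge0.
  rewrite totD// !totZ// tot_p tPAPB !mule1 -(ent_tot hp snd).
  by rewrite !lte_add_pinfty// ltry.
have [Om [mu [D [tau [V [[mu0 mu1] [Dinj [DV tau0]] [Dp De] Dt Vt]]]]]] :=
  race_coupling hp u0 eta0 pu.
exists (code_kernel p mu D); split; first exact: code_kernel_indep.
pose W := powlaw_tail k s 0; have W0 : 0 < W by exact: powlaw_tail_gt0.
pose c b w := (0 < PB b)%R%:R * ((V b w)%:R * (powlaw k s (tau b w) / W)).
have c0 b w : 0 <= c b w by rewrite /c !mulr_ge0 ?invr_ge0 ?powlaw_ge0 ?(ltW W0).
have cK b w : c b w <= K.
  have sk0 : 0 <= s / k by rewrite divr_ge0// ltW.
  rewrite /c le_max; apply/orP; right.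
  case: (0 < PB b) => /=; rewrite ?mul0r// mul1r.
  by case: (V b w); rewrite ?mul0r// mul1r powlaw_le.
have cm : (tot (fun b => \sum_w mu w * c b w)%R <= 1)%E.
  rewrite -tot_PB; apply: le_tot => b; have := PB0 b; rewrite le_eqVlt => /orP[/eqP b0|b0].
    by rewrite big1// => w _; rewrite /c -b0 ltxx mul0r mulr0.
  rewrite (eq_bigr (fun w => mu w * ((V b w)%:R * powlaw k s (tau b w)) / W)); last first.
    by move=> w _; rewrite /c b0 mul1r !mulrA.
  rewrite -mulr_suml ler_pdivrMr//; apply: Vt => //.
  - by move=> v; exact: powlaw_ge0.
  - by move=> v _; exact/ltW/powlaw_tail_gt0.
  - by move=> v h; exact: powlaw_step.
have cpos a b w : 0 < mu w -> D a b w -> 0 < p (a, b) -> 0 < c b w.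
  move=> _ Dw pp; rewrite /c (lt_le_trans pp (pmf_le_snd hp a b)) (DV _ _ _ Dw).
  by rewrite !mul1r divr_gt0// expR_gt0.
have lc a b w : D a b w -> 0 < PB b ->
    log2 K - log2 (c b w) = Z + t * (1 - ln (1 + k) + ln (k + tau b w)).
  move=> Dw b0; rewrite /c b0 (DV _ _ _ Dw) !mul1r [log2 (_ / _)]/log2 ln_powlaw//.
  by rewrite /Z /t -/L; field; rewrite gt_eqF.
pose m ab := PA ab.1 * \sum_w mu w * (D ab.1 ab.2 w)%:R.
pose T ab := PA ab.1 * \sum_w mu w * (D ab.1 ab.2 w)%:R * (log2 K - log2 (c ab.2 w)).
have lcK b w : 0 <= log2 K - log2 (c b w).
  rewrite subr_ge0; have := c0 b w; rewrite le_eqVlt => /orP[/eqP<-|cp]; last exact: log2_le.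
  by rewrite [log2 0]/log2 ln0// mul0r.
have T0 ab : 0 <= T ab by rewrite mulr_ge0// sumr_ge0// => w _; rewrite !mulr_ge0.
have m0 ab : 0 <= p ab - m ab by case: ab => a b; rewrite subr_ge0 Dp.
have ZZ0 : 0 <= `|Z| + Z by have := ler_norm (- Z); rewrite normrN; lra.
have tk0 : 0 <= t / (1 + k) := divr_ge0 t0 (ltW k1).
(* [p * ln r] is split between the sides into the summands of [H(B|A)] and [H(B)], and [|Z|] is
   added to both, so that every summand is nonnegative. *)
have main ab : T ab + ((1 + s) * (p ab * log2 (PA ab.1 / p ab)) + `|Z| * p ab) <=
    (`|Z| + Z) * p ab + ((1 + s) * (p ab * - log2 (PB ab.2)) +
    ((p ab - m ab) * u2 ab +
    t / (1 + k) * (k * (PA ab.1 * PB ab.2) + (1 + eta) * p ab))).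
  case: ab => a b /=.
  have := p0 (a, b); rewrite le_eqVlt => /orP[/eqP pz|pp].
    have T00 : T (a, b) = 0.
      have ms := Dp a b; rewrite -pz in ms.
      have mge : 0 <= \sum_w mu w * (D a b w)%:R by rewrite sumr_ge0// => w _; rewrite mulr_ge0.
      have /eqP : PA a * (\sum_w mu w * (D a b w)%:R) = 0.
        by apply/eqP; rewrite eq_le ms mulr_ge0.
      rewrite mulf_eq0 => /orP[/eqP a0|]; first by rewrite /T a0 mul0r.
      rewrite psumr_eq0; last by move=> w _; rewrite mulr_ge0.
      move=> /allP Dz; rewrite /T big1 ?mulr0// => w _ /=.
      by have /eqP -> := Dz w (mem_index_enum w); rewrite mul0r.
    have := m0 (a, b); rewrite T00 -pz !mul0r !mulr0 !add0r => m00.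
    rewrite addr0 addr_ge0 ?(mulr_ge0 m00 (u20 _))//.
    by rewrite mulr_ge0// mulr_ge0 ?(ltW k0) ?(PAPB0 (a, b)).
  have PAp : 0 < PA a := lt_le_trans pp (pmf_le_fst hp a b).
  have PBp : 0 < PB b := lt_le_trans pp (pmf_le_snd hp a b).
  have h := powlaw_cost mu0 (tau0 b) PAp PBp pp k0 t0 (Dp a b) (Dt a b pp) Z.
  have TE : T (a, b) = PA a * (\sum_w mu w * (D a b w)%:R *
      (Z + t * (1 - ln (1 + k) + ln (k + tau b w)))).
    rewrite /T /=; congr (_ * _); apply: eq_bigr => w _.
    by case Dw : (D a b w); rewrite ?mulr0 ?mul0r// (lc a).
  have lr : t * (p (a, b) * ln (r (a, b))) =
      (1 + s) * (p (a, b) * - log2 (PB b)) - (1 + s) * (p (a, b) * log2 (PA a / p (a, b))).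
    rewrite /r /t /log2 !ln_div ?posrE ?mulr_gt0//= lnM ?posrE// -/L.
    by field; rewrite gt_eqF.
  rewrite TE; move: h; rewrite -/(r (a, b)) lr /u2 -/(m (a, b)).
  by lra.
have lpA ab : 0 <= log2 (PA ab.1 / p ab).
  case: ab => a b; have := p0 (a, b); rewrite le_eqVlt => /orP[/eqP<-|pp].
    by rewrite invr0 mulr0 /log2 ln0// mul0r.
  by rewrite log2_ge0// ler_pdivlMr// mul1r; exact: pmf_le_fst.
have cbE : tot (fun ab => p ab * log2 (PA ab.1 / p ab)) = (fine (cent p snd fst))%:E.
  rewrite fineK// (cent_tot hp); apply: eq_tot => -[a b].
  by rewrite dist_swap// [dist p (fun w => (fst w, snd w)) _]dist_self.
have hbE : tot (fun ab => p ab * - log2 (PB ab.2)) = (fine (ent p snd))%:E.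
  by rewrite fineK// (ent_tot hp).
pose E2 := tot (fun ab => (p ab - m ab) * u2 ab).
pose E1 := tot (fun ab => (p ab - m ab) * u1 ab).
have E20 : (0 <= E2)%E by apply: tot_ge0 => ab; rewrite mulr_ge0.
have E10 : (0 <= E1)%E by apply: tot_ge0 => ab; rewrite mulr_ge0.
have E12 : (E1 + E2 <= eta%:E)%E.
  rewrite -totD; [|by move=> ab; rewrite mulr_ge0|by move=> ab; rewrite mulr_ge0].
  by apply: le_trans De; apply: le_tot => ab; rewrite -mulrDr.
have tT : (tot T + ((1 + s) * fine (cent p snd fst) + `|Z|)%:E <=
  (`|Z| + Z)%:E + (((1 + s) * fine (ent p snd))%:E +
   (E2 + (t / (1 + k) * (k + (1 + eta)))%:E)))%E.
  have x1 ab : 0 <= (1 + s) * (p ab * log2 (PA ab.1 / p ab)).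
    by rewrite mulr_ge0 ?(ltW s1)// mulr_ge0.
  have x2 ab : 0 <= `|Z| * p ab by rewrite mulr_ge0.
  have x3 ab : 0 <= (`|Z| + Z) * p ab by rewrite mulr_ge0.
  have x4 ab : 0 <= (1 + s) * (p ab * - log2 (PB ab.2)) by rewrite mulr_ge0 ?(ltW s1)// mulr_ge0.
  have x5 ab : 0 <= (p ab - m ab) * u2 ab by rewrite mulr_ge0.
  have x7 ab : 0 <= k * (PA ab.1 * PB ab.2) by rewrite mulr_ge0// ltW.
  have x8 ab : 0 <= (1 + eta) * p ab by rewrite mulr_ge0// addr_ge0// ltW.
  have x9 ab : 0 <= k * (PA ab.1 * PB ab.2) + (1 + eta) * p ab by rewrite addr_ge0.
  have x6 ab : 0 <= t / (1 + k) * (k * (PA ab.1 * PB ab.2) + (1 + eta) * p ab).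
    by rewrite mulr_ge0.
  have eta1 : 0 <= 1 + eta by rewrite addr_ge0// ltW.
  have pl0 ab : 0 <= p ab * log2 (PA ab.1 / p ab) by rewrite mulr_ge0.
  have pb0 ab : 0 <= p ab * - log2 (PB ab.2) by rewrite mulr_ge0.
  have x56 ab := addr_ge0 (x5 ab) (x6 ab); have x456 ab := addr_ge0 (x4 ab) (x56 ab).
  have x12 ab := addr_ge0 (x1 ab) (x2 ab).
  have := le_tot main.
  rewrite (totD T0 x12) (totD x1 x2) (totD x3 x456) (totD x4 x56) (totD x5 x6).
  rewrite (totZ (ltW s1) pl0) cbE (totZ (normr_ge0 Z) p0) tot_p mule1 -EFinM -EFinD.
  rewrite (totZ ZZ0 p0) tot_p mule1 (totZ (ltW s1) pb0) hbE -EFinM.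
  rewrite (totZ tk0 x9) (totD x7 x8) (totZ (ltW k0) PAPB0) tPAPB mule1.
  by rewrite (totZ eta1 p0) tot_p mule1 -EFinD -EFinM.
have := cent_code_kernel_le hp mu0 mu1 Dinj Dp dl0 dl1 K1 c0 cK cm cpos.
rewrite dlE -/(tot T) -/E1.
have hJ := kernel_pmf hp (code_kernelP hp mu0 mu1 Dinj Dp).
have := cent_ge0 hJ (fun w => w.1.2) snd.
set cJ := cent (fun w => (p w.1 * code_kernel p mu D w.1 w.2)%R) (fun w => w.1.2) snd.
move: cJ tT E12 E10 E20 (tot_ge0 T0) => cJ.
case: (tot T) => [tt||]//; case: E1 => [e1||]//; case: E2 => [e2'||]//.
case: cJ => [cj||]//.
rewrite -!EFinD !lee_fin => tT E12 E10 E20 T00 _ key.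
have IE : I = fine (ent p snd) - fine (cent p snd fst) by [].
have tL : (1 + s) / L = t by [].
move: boundE; rewrite IE -/L.
have -> : ((1 + s) * ln (1 + k) - s * ln k - ln s) / L = Z - log2 K + t.
  by rewrite /Z /t; field; rewrite gt_eqF.
have te : t / (1 + k) * (k + (1 + eta)) <= t + t * eta.
  rewrite mulrAC ler_pdivrMr//.
  have := mulr_ge0 (mulr_ge0 t0 (ltW eta0)) (ltW k0); lra.
move: tT E12 E10 E20 key te etaE; lra.
Qed.

End FunctionalRepresentation.

(** * Lower bounds *)

Section Independence.
Variables (R : realType) (Om : choiceType) (P : Om -> R).
Hypothesis hP : is_pmf P.
Variables (A C : choiceType) (f : Om -> A) (Y : Om -> C).
Hypothesis fY : forall a y,
  dist P (fun w => (f w, Y w)) (a, y) = dist P f a * dist P Y y.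

Lemma indep_mi0 : (ent P f < +oo)%E -> mi P f Y = 0%E.
Proof.
move=> Hf; rewrite /mi [X in (_ - X)%E](_ : _ = ent P f).
  by rewrite subee// ge0_fin_numE// ent_ge0.
rewrite cent_tot// ent_tot//; apply: eq_tot => w.
have [P0 _] := hP; have := P0 w.
rewrite le_eqVlt => /orP[/eqP<-|Pw]; first by rewrite !mul0r.
have fp := dist_gt0 hP f Pw; have yp := dist_gt0 hP Y Pw.
by congr (_ * _); rewrite fY log2_div ?mulr_gt0// log2M//; lra.
Qed.

Lemma indep_comp (B : choiceType) (h : A -> B) b y :
  dist P (fun w => (h (f w), Y w)) (b, y) =
  dist P (fun w => h (f w)) b * dist P Y y.
Proof.
rewrite -(dist_comp hP (fun w => (f w, Y w)) (fun ay => (h ay.1, ay.2))).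
have d0 := dist_ge0 hP (fun w => (f w, Y w)).
have dY0 := dist_ge0 hP Y; have df0 := dist_ge0 hP f.
apply: EFin_inj; rewrite (distE (dist_pmf hP _)) tot_pair; last first.
  by move=> i; rewrite mulr_ge0.
rewrite -(dist_comp hP f h) mulrC EFinM (distE (dist_pmf hP f)).
rewrite -totZ//; last by move=> i; rewrite mulr_ge0.
apply: eq_esum => a _; rewrite (@tot_seq _ _ [:: y])//.
- by rewrite big_seq1 /= xpair_eqE eqxx andbT fY; congr (_%:E); ring.
- by move=> i; rewrite mulr_ge0.
- by move=> i; rewrite inE /= xpair_eqE => /negPf ->; rewrite andbF mul0r.
Qed.

End Independence.

Section KernelPush.
Variables (R : realType) (Om : choiceType) (P : Om -> R).
Hypothesis hP : is_pmf P.

Section Any.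
Variable q : Om -> nat -> R.
Hypothesis q0 : forall w y, 0 <= q w y.
Hypothesis q1 : forall w, \esum_(y in [set: nat]) (q w y)%:E = 1%E.
Let J (v : Om * nat) : R := P v.1 * q v.1 v.2.
Let P0 w : 0 <= P w. Proof. by case: hP. Qed.
Let hJ : is_pmf J. Proof. exact: kernel_pmf. Qed.

Lemma dist_kernel_pair (B : choiceType) (f : Om -> B) b y :
  (dist J (fun v => (f v.1, v.2)) (b, y))%:E =
  tot (fun w => (f w == b)%:R * (P w * q w y)).
Proof.
rewrite (distE hJ) tot_pair; last by move=> i; rewrite !mulr_ge0.
apply: eq_esum => w _; rewrite (@tot_seq _ _ [:: y])//.
- by rewrite big_seq1 /J /= xpair_eqE eqxx andbT.
- by move=> i; rewrite !mulr_ge0.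
- by move=> i; rewrite inE /= xpair_eqE => /negPf ->; rewrite andbF mul0r.
Qed.

Lemma dist_kernel_snd y : (dist J snd y)%:E = tot (fun w => P w * q w y).
Proof.
rewrite (distE hJ) tot_pair; last by move=> i; rewrite !mulr_ge0.
apply: eq_esum => w _; rewrite (@tot_seq _ _ [:: y])//.
- by rewrite big_seq1 /J /= eqxx mul1r.
- by move=> i; rewrite !mulr_ge0.
- by move=> i; rewrite inE /= => /negPf ->; rewrite mul0r.
Qed.

End Any.

Variables (A B : countType) (fa : Om -> A) (fb : Om -> B).
Let p := dist P (fun w => (fa w, fb w)).
Let hp : is_pmf p. Proof. exact: dist_pmf. Qed.
Variable q : A * B -> nat -> R.
Hypothesis qi : indep_kernel p q.
Let q' w y := q (fa w, fb w) y.
Let q0 : forall ab y, 0 <= q ab y. Proof. by case: qi. Qed.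
Let q'0 w y : 0 <= q' w y. Proof. exact: q0. Qed.
Let q'1 w : \esum_(y in [set: nat]) (q' w y)%:E = 1%E.
Proof. by case: qi => _ + _; apply. Qed.
Let J' (v : Om * nat) : R := P v.1 * q' v.1 v.2.
Let J (v : (A * B) * nat) : R := p v.1 * q v.1 v.2.
Let hJ' : is_pmf J'. Proof. exact: kernel_pmf. Qed.
Let P0 w : 0 <= P w. Proof. by case: hP. Qed.

(** [Y] depends on the outcome only through [(fa, fb)], so kernels built for the law of the pair
    carry over to the full space. *)
Lemma dist_kernel_push : dist J' (fun v => ((fa v.1, fb v.1), v.2)) = J.
Proof.
apply/funext => -[ab y]; apply: EFin_inj.
rewrite (dist_kernel_pair q'0 q'1 (fun w => (fa w, fb w))) /J /p mulrC EFinM distE//.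
rewrite -totZ//; last by move=> w; rewrite mulr_ge0.
apply: eq_tot => w; case: eqP => [e|_]; last by rewrite !mul0r mulr0.
by rewrite /q' e !mul1r mulrC.
Qed.

Let dist_push (D : choiceType) (h : (A * B) * nat -> D) :
  dist J' (fun v => h ((fa v.1, fb v.1), v.2)) = dist J h.
Proof. by apply/funext => d; rewrite -dist_kernel_push dist_comp. Qed.

Lemma kernel_push_indep a y :
  dist J' (fun v => (fa v.1, v.2)) (a, y) = dist J' (fun v => fa v.1) a * dist J' snd y.
Proof.
rewrite (dist_push (fun v => (v.1.1, v.2))) (dist_push snd).
case: qi => _ _ ->; congr (_ * _).
by rewrite (dist_kernel_fst hP (conj q'0 q'1)) /p dist_comp.
Qed.

Lemma cent_kernel_push :
  cent J' (fun v => fb v.1) snd = cent J (fun v => v.1.2) snd.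
Proof.
rewrite /cent (dist_push snd) (dist_push (fun v => (v.1.2, v.2))).
done.
Qed.

End KernelPush.

(** * Time sharing *)

Section TimeSharing.
Variables (R : realType) (Om : choiceType) (P : Om -> R).
Hypothesis hP : is_pmf P.
Variables (q0 q1 : Om -> nat -> R) (t : R).
Hypotheses (t0 : 0 <= t) (t1 : t <= 1).
Hypothesis h0 : (forall w y, 0 <= q0 w y) /\
  (forall w, \esum_(y in [set: nat]) (q0 w y)%:E = 1%E).
Hypothesis h1 : (forall w y, 0 <= q1 w y) /\
  (forall w, \esum_(y in [set: nat]) (q1 w y)%:E = 1%E).

Lemma tot_even_odd (F : nat -> R) : (forall n, 0 <= F n) ->
  tot F = (tot (fun n => F n.*2) + tot (fun n => F n.*2.+1))%E.
Proof.
move=> F0; rewrite /tot (esumID [set n | odd n]); last by move=> i _; rewrite lee_fin.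
rewrite addeC !setTI; congr (_ + _)%E.
  rewrite (@reindex_esum R nat nat setT _ double)//; split.
  - by move=> n _ /=; rewrite odd_double.
  - by move=> m n _ _ /double_inj.
  - by move=> n /= /negP on; exists n./2; rewrite // even_halfK.
rewrite (@reindex_esum R nat nat setT _ (fun n => n.*2.+1))//; split.
- by move=> n _ /=; rewrite odd_double.
- by move=> m n _ _ [] /double_inj.
- by move=> n /= on; exists n./2; rewrite // odd_halfK ?prednK// odd_gt0.
Qed.

(** The parity of [Y] reveals which kernel was used, so the switching variable is part of the
    representation. *)
Definition time_share w y : R :=
  if odd y then t * q1 w y./2 else (1 - t) * q0 w y./2.

Let u0 : 0 <= 1 - t. Proof. by rewrite subr_ge0. Qed.

Lemma time_shareP : (forall w y, 0 <= time_share w y) /\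
  (forall w, \esum_(y in [set: nat]) (time_share w y)%:E = 1%E).
Proof.
have [q00 q01] := h0; have [q10 q11] := h1.
have ts0 w y : 0 <= time_share w y by rewrite /time_share; case: ifP; rewrite mulr_ge0.
split => // w; rewrite -/(tot (time_share w)) tot_even_odd// /time_share.
under eq_tot do rewrite odd_double doubleK.
under [X in (_ + X)%E]eq_tot do rewrite /= odd_double uphalf_double.
by rewrite !totZ// /tot q01 q11 !mule1 -EFinD subrK.
Qed.

Let Q (q : Om -> nat -> R) (v : Om * nat) : R := P v.1 * q v.1 v.2.

(** The sum splits by parity, and in each half the factor [t] or [1 - t] cancels inside the
    logarithm. The mixture is therefore exact, which preserves [I(S;Y) = 0]. *)
Lemma cent_time_share (B : choiceType) (f : Om -> B) :
  cent (Q time_share) (fun v => f v.1) snd =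
  ((1 - t)%:E * cent (Q q0) (fun v => f v.1) snd +
   t%:E * cent (Q q1) (fun v => f v.1) snd)%E.
Proof.
have [P0 _] := hP.
have [[q00 q01] [q10 q11] [s0 s1]] := And3 h0 h1 time_shareP.
have hQ0 : is_pmf (Q q0) := kernel_pmf hP h0.
have hQ1 : is_pmf (Q q1) := kernel_pmf hP h1.
have hQs : is_pmf (Q time_share) := kernel_pmf hP time_shareP.
have nn (q : Om -> nat -> R) : is_pmf (Q q) -> forall by_ : B * nat,
    0 <= dist (Q q) (fun v => (f v.1, v.2)) by_ *
      log2 (dist (Q q) snd by_.2 / dist (Q q) (fun v => (f v.1, v.2)) by_).
  move=> hq [b y]; rewrite mulr_ge0 ?dist_ge0//.
  by apply: (log2_ratio_ge0 hq) => w [].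
have sc (c x y : R) : c * x * log2 (c * y / (c * x)) = c * (x * log2 (y / x)).
  have [->|c0] := eqVneq c 0; first by rewrite !mul0r.
  by rewrite -mulrA; congr (_ * (_ * log2 _)); rewrite invfM mulrACA divff// mul1r.
have pe b y : dist (Q time_share) (fun v => (f v.1, v.2)) (b, y.*2) =
    (1 - t) * dist (Q q0) (fun v => (f v.1, v.2)) (b, y).
  apply: EFin_inj; rewrite EFinM !dist_kernel_pair// -totZ//; last first.
    by move=> w; rewrite !mulr_ge0.
  by apply: eq_tot => w; rewrite /time_share odd_double doubleK /=; ring.
have po b y : dist (Q time_share) (fun v => (f v.1, v.2)) (b, y.*2.+1) =
    t * dist (Q q1) (fun v => (f v.1, v.2)) (b, y).
  apply: EFin_inj; rewrite EFinM !dist_kernel_pair// -totZ//; last first.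
    by move=> w; rewrite !mulr_ge0.
  by apply: eq_tot => w; rewrite /time_share /= odd_double uphalf_double /=; ring.
have me y : dist (Q time_share) snd y.*2 = (1 - t) * dist (Q q0) snd y.
  apply: EFin_inj; rewrite EFinM !dist_kernel_snd// -totZ//; last first.
    by move=> w; rewrite !mulr_ge0.
  by apply: eq_tot => w; rewrite /time_share odd_double doubleK /=; ring.
have mo y : dist (Q time_share) snd y.*2.+1 = t * dist (Q q1) snd y.
  apply: EFin_inj; rewrite EFinM !dist_kernel_snd// -totZ//; last first.
    by move=> w; rewrite !mulr_ge0.
  by apply: eq_tot => w; rewrite /time_share /= odd_double uphalf_double /=; ring.
rewrite /cent -!/(tot _) tot_pair; last exact: nn.
rewrite [X in (_ * X + _)%E]tot_pair; last exact: nn.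
rewrite [X in (_ + _ * X)%E]tot_pair; last exact: nn.
rewrite -!esumZ//; last 2 first.
- by move=> b; apply: tot_ge0 => y; exact: nn.
- by move=> b; apply: tot_ge0 => y; exact: nn.
rewrite -esumD; last 2 first.
- by move=> b _; rewrite mule_ge0 ?lee_fin//; apply: tot_ge0 => y; exact: nn.
- by move=> b _; rewrite mule_ge0 ?lee_fin//; apply: tot_ge0 => y; exact: nn.
apply: eq_esum => b _; rewrite tot_even_odd; last by move=> y; exact: nn.
rewrite -!totZ//; last 2 first.
- by move=> y; exact: nn.
- by move=> y; exact: nn.
by congr (_ + _)%E; apply: eq_tot => y /=; rewrite ?pe ?po ?me ?mo sc.
Qed.

End TimeSharing.

Section LowerBounds.
Variables (R : realType) (S : finType) (X T : countType).
Variable P : (S * X * T)%type -> R.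
Hypothesis hP : is_pmf P.
Hypothesis HX : (ent P (@vX S X T) < +oo)%E.
Hypothesis HT : (ent P (@vT S X T) < +oo)%E.

Let HS : (ent P (@vS S X T) < +oo)%E. Proof. exact: ent_finType. Qed.

Definition achievable (r v : R) := exists q, [/\ is_kernel q,
  mi (joint P q) (@wS S X T) (@wY S X T) = 0%E,
  (mi (joint P q) (@wX S X T) (@wY S X T) <= r%:E)%E &
  (v%:E <= mi (joint P q) (@wT S X T) (@wY S X T))%E].

Lemma achievable_le_g0 r v : achievable r v -> (v%:E <= g0 r P)%E.
Proof.
move=> [q [hq mS mX vT]]; apply: (le_trans vT).
by apply: ereal_sup_ubound; exists q.
Qed.

Lemma achievable_mono r r' v v' : r <= r' -> v' <= v -> achievable r v -> achievable r' v'.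
Proof.
move=> rr vv [q [hq mS mX vT]]; exists q; split=> //.
  by apply: (le_trans mX); rewrite lee_fin.
by apply: le_trans vT; rewrite lee_fin.
Qed.

Lemma ent_pair_lty (Om : choiceType) (Q : Om -> R) (A B : choiceType)
    (f : Om -> A) (g : Om -> B) : is_pmf Q ->
  (ent Q f < +oo)%E -> (ent Q g < +oo)%E ->
  (ent Q (fun w => (f w, g w)) < +oo)%E.
Proof.
move=> hQ Hf Hg; rewrite chain_rule// lte_add_pinfty//.
exact: le_lt_trans (cent_le_ent hQ f g) Hf.
Qed.

Let mi_ge (q : (S * X * T)%type -> nat -> R) (c : R) : is_kernel q ->
  (cent (joint P q) (@wT S X T) (@wY S X T) <= c%:E)%E ->
  ((fine (ent P (@vT S X T)) - c)%:E <= mi (joint P q) (@wT S X T) (@wY S X T))%E.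
Proof.
move=> hq cT; rewrite /mi (_ : ent (joint P q) _ = ent P (@vT S X T)); last first.
  exact: (ent_kernel_fst hP hq (@vT S X T)).
rewrite EFinB fineK ?ge0_fin_numE ?ent_ge0//.
by rewrite leeB.
Qed.

(** Independence of [Y] from the pair [(X, S)] passes to both of its components. *)
Lemma achievable_zero (c : R) (q : (X * S) * T -> nat -> R) :
  indep_kernel (dist P (fun w => (vXS w, vT w))) q ->
  (cent (fun w => (dist P (fun w => (vXS w, vT w)) w.1 * q w.1 w.2)%R)
    (fun w => w.1.2) snd <= c%:E)%E ->
  achievable 0 (fine (ent P (@vT S X T)) - c).
Proof.
move=> qi cT; pose q' (w : S * X * T) y := q (vXS w, vT w) y.
have hq : is_kernel q' by case: qi => q0 q1 _; split=> [w y|w]; [exact: q0|exact: q1].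
have hJ : is_pmf (joint P q') := kernel_pmf hP hq.
have ind := kernel_push_indep hP qi.
exists q'; split=> //.
- apply: indep_mi0 => //; last exact: ent_finType.
  exact: (indep_comp hJ ind (fun xs => xs.2)).
- rewrite indep_mi0 ?lexx//; first exact: (indep_comp hJ ind (fun xs => xs.1)).
  by rewrite (_ : ent (joint P q') _ = ent P (@vX S X T))//; exact: (ent_kernel_fst hP hq (@vX S X T)).
- by apply: mi_ge => //; rewrite -[X in (X <= _)%E](cent_kernel_push hP qi) in cT *.
Qed.

(** [Y] is independent of [S] only, so [I(X;Y)] is bounded by [H(X|S)]; and [H(T|Y)] is at most
    [H(X,T|Y)], the quantity controlled by the code. *)
Lemma achievable_cent (c : R) (q : S * (X * T) -> nat -> R) :
  indep_kernel (dist P (fun w => (vS w, (vX w, vT w)))) q ->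
  (cent (fun w => (dist P (fun w => (vS w, (vX w, vT w))) w.1 * q w.1 w.2)%R)
    (fun w => w.1.2) snd <= c%:E)%E ->
  achievable (fine (cent P (@vX S X T) (@vS S X T))) (fine (ent P (@vT S X T)) - c).
Proof.
move=> qi cT; pose q' (w : S * X * T) y := q (vS w, (vX w, vT w)) y.
have hq : is_kernel q' by case: qi => q0 q1 _; split=> [w y|w]; [exact: q0|exact: q1].
have hJ : is_pmf (joint P q') := kernel_pmf hP hq.
have ind := kernel_push_indep hP qi.
have mS : mi (joint P q') (@wS S X T) (@wY S X T) = 0%E.
  by apply: indep_mi0 => //; exact: ent_finType.
exists q'; split=> //.
- have := mi_le_cent_add hP hq (f := @vX S X T) (g := @vS S X T) (r := 0) HX HS.
  rewrite adde0 fineK; last first.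
    by rewrite ge0_fin_numE ?cent_ge0// (le_lt_trans (cent_le_ent hP _ _)).
  by apply; rewrite -[X in (X <= _)%E]/(mi (joint P q') _ _) mS.
- apply: mi_ge => //; apply: le_trans cT; rewrite -(cent_kernel_push hP qi).
  exact: (@cent_mono _ _ _ hJ _ _ _ _ (fun v => (vX v.1, vT v.1)) _ snd).
Qed.

Lemma achievable_share (t r0 r1 v0 v1 : R) : 0 <= t -> t <= 1 ->
  achievable r0 v0 -> achievable r1 v1 ->
  achievable ((1 - t) * r0 + t * r1) ((1 - t) * v0 + t * v1).
Proof.
move=> t0 t1 [q0 [h0 mS0 mX0 mT0]] [q1 [h1 mS1 mX1 mT1]].
have hq := time_shareP t0 t1 h0 h1.
have miE (B : choiceType) (f : (S * X * T)%type -> B) : (ent P f < +oo)%E ->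
    mi (joint P (time_share q0 q1 t)) (fun v => f v.1) snd =
    ((1 - t)%:E * mi (joint P q0) (fun v => f v.1) snd +
     t%:E * mi (joint P q1) (fun v => f v.1) snd)%E /\
    mi (joint P q0) (fun v => f v.1) snd \is a fin_num /\
    mi (joint P q1) (fun v => f v.1) snd \is a fin_num.
  move=> Hf; rewrite /mi.
  rewrite (ent_kernel_fst hP hq) (ent_kernel_fst hP h0) (ent_kernel_fst hP h1).
  rewrite (cent_time_share hP t0 t1 h0 h1 f).
  have fin (q : (S * X * T)%type -> nat -> R) : is_kernel q ->
      cent (joint P q) (fun v => f v.1) snd \is a fin_num.
    move=> hk; have hJ : is_pmf (joint P q) := kernel_pmf hP hk.
    rewrite ge0_fin_numE ?cent_ge0//; apply: le_lt_trans (cent_le_ent hJ _ _) _.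
    by rewrite (ent_kernel_fst hP hk).
  have := fin _ h0; have := fin _ h1.
  have : ent P f \is a fin_num by rewrite ge0_fin_numE// ent_ge0.
  case: (ent P f) => [e||]// _.
  rewrite -![cent (fun v => (P v.1 * _ v.1 v.2)%R) _ _]/(cent (joint P _) _ _).
  case: (cent (joint P q1) _ _) => [c1||]// _; case: (cent (joint P q0) _ _) => [c0||]// _.
  split=> //; transitivity ((e - ((1 - t) * c0 + t * c1))%:E); first by [].
  by rewrite (_ : e - _ = (1 - t) * (e - c0) + t * (e - c1)); last by ring.
exists (time_share q0 q1 t); split=> //.
- have [-> _] := miE _ (@vS S X T) HS.
  rewrite -[X in (_ * X + _)%E]/(mi (joint P q0) (@wS S X T) (@wY S X T)) mS0.
  by rewrite -[X in (_ + _ * X)%E]/(mi (joint P q1) (@wS S X T) (@wY S X T)) mS1 !mule0 adde0.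
- have [-> [f0 f1]] := miE _ (@vX S X T) HX.
  move: mX0 mX1 f0 f1.
  rewrite -![mi _ (@wX S X T) (@wY S X T)]/(mi _ (fun v => vX v.1) snd).
  case: (mi (joint P q0) _ _) => [m0||]//; case: (mi (joint P q1) _ _) => [m1||]//.
  rewrite -!EFinM -EFinD !lee_fin => a b _ _.
  by rewrite lerD// ler_wpM2l// subr_ge0.
- have [-> [f0 f1]] := miE _ (@vT S X T) HT.
  move: mT0 mT1 f0 f1.
  rewrite -![mi _ (@wT S X T) (@wY S X T)]/(mi _ (fun v => vT v.1) snd).
  case: (mi (joint P q0) _ _) => [m0||]//; case: (mi (joint P q1) _ _) => [m1||]//.
  rewrite -!EFinM -EFinD !lee_fin => a b _ _.
  by rewrite lerD// ler_wpM2l// subr_ge0.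
Qed.

Let HXS : (ent P (@vXS S X T) < +oo)%E. Proof. exact: (ent_pair_lty hP HX HS). Qed.

Let fin_ent (B : choiceType) (f : (S * X * T)%type -> B) : (ent P f < +oo)%E ->
  (fine (ent P f))%:E = ent P f.
Proof. by move=> Hf; rewrite fineK// ge0_fin_numE// ent_ge0. Qed.

Let fin_cent (A B : choiceType) (f : (S * X * T)%type -> A) (g : (S * X * T)%type -> B) :
  (ent P f < +oo)%E -> (fine (cent P f g))%:E = cent P f g.
Proof.
move=> Hf; rewrite fineK// ge0_fin_numE ?cent_ge0//.
exact: le_lt_trans (cent_le_ent hP f g) Hf.
Qed.

Let HTr := fine (ent P (@vT S X T)).
Let HXSr := fine (ent P (@vXS S X T)).
Let HTgXSr := fine (cent P (@vT S X T) (@vXS S X T)).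
Let Ir := HTr - HTgXSr.
Let Logr := log2 (Ir + 551%:R / 100%:R) + 106%:R / 100%:R.

Let pXST_snd : ent (dist P (fun w => (vXS w, vT w))) snd = ent P (@vT S X T).
Proof. by rewrite /ent; apply: eq_esum => t _; rewrite dist_comp. Qed.

Lemma achievable_frl (eps : R) : 0 < eps -> achievable 0 (HTr - HXSr - eps).
Proof.
move=> e0; have hp := dist_pmf hP (fun w => (vXS w, vT w)).
have Hs : (ent (dist P (fun w => (vXS w, vT w))) snd < +oo)%E by rewrite pXST_snd.
have [q [qi cq]] := indep_kernel_ent hp Hs e0.
rewrite -addrA -opprD; apply: (achievable_zero qi); apply: (le_trans cq).
rewrite EFinD leeD2r// /HXSr fin_ent//.
have -> // : ent (dist P (fun w => (vXS w, vT w))) fst = ent P (@vXS S X T).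
by rewrite /ent; apply: eq_esum => t _; rewrite dist_comp.
Qed.

Lemma achievable_sfrl (eps : R) : 0 < eps -> achievable 0 (HTr - (Ir + Logr) - eps).
Proof.
move=> e0; have hp := dist_pmf hP (fun w => (vXS w, vT w)).
have Hs : (ent (dist P (fun w => (vXS w, vT w))) snd < +oo)%E by rewrite pXST_snd.
have [q [qi cq]] := indep_kernel_mi hp Hs e0.
rewrite -addrA -opprD; apply: (achievable_zero qi); move: cq.
rewrite pXST_snd.
have -> : cent (dist P (fun w => (vXS w, vT w))) snd fst = cent P (@vT S X T) (@vXS S X T).
  rewrite /cent; apply: eq_esum => -[t xs] _; rewrite (dist_comp hP _ fst).
  by rewrite (dist_comp hP _ (fun v => (v.2, v.1))).
exact.
Qed.

Lemma achievable_frl_S (eps : R) : 0 < eps ->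
  achievable (fine (cent P (@vX S X T) (@vS S X T))) (HTr - fine (ent P (@vS S X T)) - eps).
Proof.
move=> e0; have hp := dist_pmf hP (fun w => (vS w, (vX w, vT w))).
have Hs : (ent (dist P (fun w => (vS w, (vX w, vT w)))) snd < +oo)%E.
  rewrite (_ : ent _ snd = ent P (fun w => (vX w, vT w))); first exact: ent_pair_lty.
  by rewrite /ent; apply: eq_esum => t _; rewrite dist_comp.
have [q [qi cq]] := indep_kernel_ent hp Hs e0.
rewrite -addrA -opprD; apply: (achievable_cent qi); apply: (le_trans cq).
rewrite EFinD leeD2r// fin_ent//.
have -> // : ent (dist P (fun w => (vS w, (vX w, vT w)))) fst = ent P (@vS S X T).
by rewrite /ent; apply: eq_esum => t _; rewrite dist_comp.
Qed.

Lemma le_g0_eps (r v : R) : (forall eps, 0 < eps -> achievable r (v - eps)) ->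
  (v%:E <= g0 r P)%E.
Proof.
move=> h; apply/lee_addgt0Pr => eps e0.
rewrite -leeBlDr// -EFinB; exact/achievable_le_g0/h.
Qed.

End LowerBounds.
Unset Implicit Arguments. Set Strict Implicit. Set Printing Implicit Defensive.
Theorem theorem1 (R : realType) (S : finType) (X T : countType)
  (P : (S * X * T)%type -> R) :
  is_pmf P ->
  (ent P (@vX S X T) < +oo)%E ->
  (ent P (@vT S X T) < +oo)%E ->
  let HTgXS := fine (cent P (@vT S X T) (@vXS S X T)) in
  let HXSgT := fine (cent P (@vXS S X T) (@vT S X T)) in
  let HXgS := fine (cent P (@vX S X T) (@vS S X T)) in
  let IXST := fine (mi P (@vT S X T) (@vXS S X T)) in
  let HT := fine (ent P (@vT S X T)) in
  let HX := fine (ent P (@vX S X T)) in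
  let HS := fine (ent P (@vS S X T)) in
  let HXS := fine (ent P (@vXS S X T)) in
  let L2 := HTgXS - (log2 (IXST + 551%:R / 100%:R) + 106%:R / 100%:R) in
  let UB (r : R) :=
    (g0 r P <= cent P (@vT S X T) (@vX S X T) + r%:E)%E /\
    (g0 r P <= cent P (@vT S X T) (@vS S X T))%E /\
    (g0 r P <= U0 P)%E in
  (forall r : R, 0 <= r -> r <= HXgS ->
     let alpha := r / HXgS in
     let L1 := HTgXS + r - HXSgT in
     let L3 := HTgXS + r - alpha * HXSgT - 106%:R / 100%:R
               - log2 ((1 - alpha) * IXST + alpha * Num.min HT HXS
                       + 551%:R / 100%:R) in
     ((L1%:E <= g0 r P)%E /\ (L2%:E <= g0 r P)%E /\ (L3%:E <= g0 r P)%E)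
     /\ UB r) /\
  (forall r : R, HXgS <= r -> r < HX ->
     let L1' := HT - HS in
     ((L1'%:E <= g0 r P)%E /\ (L2%:E <= g0 r P)%E) /\ UB r).
Proof.
set c := 551%:R / 100%:R; set d := 106%:R / 100%:R.
have c1 : 1 <= c by rewrite /c; lra.
have d0 : 0 <= d by rewrite /d; lra.
move=> hP HX HT.
have B2 eps e0 : achievable P 0 (_ - (_ + (log2 (_ + c) + d)) - eps) :=
  achievable_sfrl hP HX HT e0.
clearbody c d; move=> HTgXS HXSgT HXgS IXST HTr HXr HSr HXS L2 UB.
have HSo : (ent P (@vS S X T) < +oo)%E by exact: ent_finType.
have HXSo : (ent P (@vXS S X T) < +oo)%E by exact: (ent_pair_lty hP HX HSo).
have fin_ent (B : choiceType) (f : (S * X * T)%type -> B) : (ent P f < +oo)%E ->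
    (fine (ent P f))%:E = ent P f.
  by move=> Hf; rewrite fineK// ge0_fin_numE// ent_ge0.
have fin_cent (A B : choiceType) (f : (S * X * T)%type -> A) (g : (S * X * T)%type -> B) :
    (ent P f < +oo)%E -> (fine (cent P f g))%:E = cent P f g.
  move=> Hf; rewrite fineK// ge0_fin_numE ?cent_ge0//.
  exact: le_lt_trans (cent_le_ent hP f g) Hf.
have IE : IXST = HTr - HTgXS.
  by apply: EFin_inj; rewrite EFinB /IXST /mi -(fin_ent _ _ HT) -(fin_cent _ _ _ (@vXS S X T) HT).
have eT : HTr%:E = ent P (@vT S X T) := fin_ent _ _ HT.
have eS : HSr%:E = ent P (@vS S X T) := fin_ent _ _ HSo.
have eXS : HXS%:E = ent P (@vXS S X T) := fin_ent _ _ HXSo.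
have cT : HTgXS%:E = cent P (@vT S X T) (@vXS S X T) := fin_cent _ _ _ _ HT.
have cXS : HXSgT%:E = cent P (@vXS S X T) (@vT S X T) := fin_cent _ _ _ _ HXSo.
have cX : HXgS%:E = cent P (@vX S X T) (@vS S X T) := fin_cent _ _ _ _ HX.
have chain1 : HXS = HXgS + HSr.
  apply: EFin_inj; rewrite EFinD eXS cX eS.
  exact: (chain_rule hP (@vX S X T) (@vS S X T)).
have chain2 : HTgXS + HXS = HXSgT + HTr.
  apply: EFin_inj; rewrite !EFinD cT eXS cXS eT.
  by rewrite -!chain_rule// ent_swap.
have HXSgT0 : 0 <= HXSgT by rewrite -lee_fin cXS cent_ge0.
have HTgXS0 : 0 <= HTgXS by rewrite -lee_fin cT cent_ge0.
have HXgS0 : 0 <= HXgS by rewrite -lee_fin cX cent_ge0.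
have I0 : 0 <= IXST by rewrite IE subr_ge0 -lee_fin eT cT cent_le_ent.
have UBr r : UB r.
  split; first exact: g0_le_centX.
  by split; [exact: g0_le_centS | exact: g0_le_U0].
have L2E eps : 0 < eps -> achievable P 0 (L2 - eps).
  move=> e0; have := B2 _ e0.
  rewrite -/HTr -/HTgXS -IE; apply: achievable_mono => //.
  by rewrite /L2 IE; lra.
have B1 eps : 0 < eps -> achievable P 0 (HTr - HXS - eps) by exact: achievable_frl.
have B3 eps : 0 < eps -> achievable P HXgS (HTr - HSr - eps) by exact: achievable_frl_S.
clearbody HTgXS HXSgT HXgS HTr HSr HXS.
have L2r r : 0 <= r -> (L2%:E <= g0 r P)%E.
  move=> r0; apply: le_g0_eps => eps e0.
  exact: achievable_mono r0 (lexx _) (L2E _ e0).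
split=> r r0 r1.
- move=> alpha L1 L3; split; last exact: UBr.
  (* If [H(X|S) = 0] then [r = 0], and [alpha] is 0 by the convention for division by zero. *)
  have rE : r = (1 - alpha) * 0 + alpha * HXgS.
    rewrite mulr0 add0r /alpha; have [H0|Hn0] := eqVneq HXgS 0.
      by rewrite H0 mulr0; apply/eqP; rewrite eq_le r0 andbT -H0.
    by rewrite divfK.
  have a0 : 0 <= alpha by rewrite divr_ge0.
  have a1 : alpha <= 1.
    have := HXgS0; rewrite /alpha le_eqVlt => /orP[/eqP<-|Hp]; first by rewrite invr0 mulr0.
    by rewrite ler_pdivrMr// mul1r.
  have rE' : r = alpha * HXgS by rewrite rE mulr0 add0r.
  split; [|split; first exact: L2r]; apply: le_g0_eps => eps e0.
  (* Mixing [H(T) - H(X,S)] with [H(T) - H(S)] adds [alpha * H(X|S) = r] to the former, by the chain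
     rule. *)
  + rewrite rE; apply: achievable_mono (lexx _) _ (achievable_share hP HX HT a0 a1 (B1 _ e0) (B3 _ e0)).
    rewrite /L1 rE'; have := congr1 ( *%R alpha) chain1; lra.
  + rewrite rE; apply: achievable_mono (lexx _) _ (achievable_share hP HX HT a0 a1 (L2E _ e0) (B3 _ e0)).
    (* The mixture pays only the fraction [1 - alpha] of [log2 (I + c) + d]. [L3] is weaker: it
       charges all of [d], and a logarithm that is larger because [I] is at most the minimum. *)
    have mn : IXST <= Num.min HTr HXS.
      rewrite le_min IE lerBlDr lerDl HTgXS0 /=; lra.
    set l1 := log2 (IXST + c).
    have l10 : 0 <= l1 by rewrite log2_ge0//; lra.
    have l12 : l1 <= log2 ((1 - alpha) * IXST + alpha * Num.min HTr HXS + c).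
      apply: log2_le; first lra.
      have := ler_wpM2l a0 mn; lra.
    rewrite /L3 /L2 -/l1; move: l12; move: (log2 (_ + _)) => l2 l12.
    have al := mulr_ge0 a0 l10; have ad := mulr_ge0 a0 d0.
    have q1 := congr1 ( *%R alpha) chain1; have q2 := congr1 ( *%R alpha) chain2.
    rewrite rE'; lra.
- have r00 : 0 <= r by exact: le_trans r0.
  move=> L1'; split; last exact: UBr.
  split; last exact: L2r.
  apply: le_g0_eps => eps e0.
  exact: achievable_mono r0 (lexx _) (B3 _ e0).
Qed.
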